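(* Let $p\ge5$ be a prime and $\ell_p=(p-1)/2$. The vector of normalized Mordell–Appell integrals $\mathcal L^{(p)}(t)=(\mathcal L^{(p)}_1(t),\dots,\mathcal L^{(p)}_{\ell_p}(t))^T$ is a vector-valued modular form of weight $1/2$, transforming under the modular $S$ transformation $\tau\to-1/\tau$ ($t\to\pi^2/t$) as $$\mathcal L^{(p)}(t)=\sqrt{\frac{\pi}{t}}\;M^{(p)}\,\mathcal L^{(p)}\!\left(\frac{\pi^2}{t}\right).$$ Here $M^{(p)}$ is an $\ell_p\times\ell_p$ mixing matrix, with entries $$M^{(p)}_{jk}=\frac{2}{\sqrt p}\,(-1)^{j+k+\lfloor\frac{p+3}{6}\rfloor}\sin\left(\frac{6jk\pi}{p}\right).$$
   Context: $t=-\pi i\tau$ with $\Im\tau>0$, i.e. $\Re t>0$. For $\Re t>0$, $JS_{(P,a)}(t)=\frac1t\int_0^\infty e^{-Pu^2/t}\,\frac{\sinh((P-a)u)}{\sinh(Pu)}\,du$, $1\le a\le 2P-1$. For $1\le j\le\ell_p$, $$\mathcal L^{(p)}_j(t)=\sqrt{\frac{48pt}{\pi}}\Bigl[\mathrm{sign}(6j-p)\,JS_{(12p,|12j-2p|)}(t)+JS_{(12p,14p-12j)}(t)+JS_{(12p,12j+2p)}(t)+JS_{(12p,10p-12j)}(t)\Bigr].$$ *)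

(* Defs.v *)
From HB Require Import structures.
From mathcomp Require Export all_boot all_order all_algebra.
From mathcomp Require Export all_classical all_reals all_analysis.
From mathcomp Require Export complex.

Set Implicit Arguments.
Unset Strict Implicit.
Unset Printing Implicit Defensive.

Export Order.TTheory GRing.Theory Num.Theory.
Export numFieldNormedType.Exports.

Local Open Scope classical_set_scope.
Local Open Scope ring_scope.
Local Open Scope complex_scope.

Definition cexp (R : realType) (z : R[i]) : R[i] :=
  (expR (complex.Re z) * cos (complex.Im z)) +i* (expR (complex.Re z) * sin (complex.Im z)).

Definition sinh (R : realType) (x : R) : R := (expR x - expR (- x)) / 2.

Definition cintegral (R : realType) (D : set R) (f : R -> R[i]) : R[i] :=
  (\int[lebesgue_measure]_(u in D) complex.Re (f u)) +i*
  (\int[lebesgue_measure]_(u in D) complex.Im (f u)).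

(* At u = 0 the quotient of hyperbolic sines takes the value 0 / 0 = 0; a single
   point does not affect the integral. *)
Definition JS (R : realType) (P a : int) (t : R[i]) : R[i] :=
  t^-1 * cintegral `[0, +oo[
    (fun u : R => cexp (- (P%:~R * u ^+ 2)%:C / t)
                  * (sinh ((P - a)%:~R * u) / sinh (P%:~R * u))%:C).

(* [sqrtc] is the principal branch (nonnegative real part), unlike [sqrtC], whose
   values have nonnegative imaginary part. *)
Definition calL_coord (R : realType) (p j : int) (t : R[i]) : R[i] :=
  sqrtc ((48 * p)%:~R * t / pi%:C) *
    ((Num.sg (6 * j - p))%:~R * JS (12 * p) `|12 * j - 2 * p| t
     + JS (12 * p) (14 * p - 12 * j) t
     + JS (12 * p) (12 * j + 2 * p) t
     + JS (12 * p) (10 * p - 12 * j) t).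

Definition ell (p : nat) : nat := (p.-1 %/ 2)%N.

(* An ordinal i < ell p stands for the index i + 1 of 1, ..., ell p. *)
Definition calL (R : realType) (p : nat) (t : R[i]) : 'cV[R[i]]_(ell p) :=
  \col_(i < ell p) calL_coord (Posz p) (Posz i.+1) t.

Definition mixing_mx (R : realType) (p : nat) : 'M[R]_(ell p) :=
  \matrix_(i < ell p, k < ell p)
    (2 / Num.sqrt p%:R * (-1) ^+ (i.+1 + k.+1 + (p + 3) %/ 6)%N
     * sin (6 * i.+1%:R * k.+1%:R * pi / p%:R)).

(* Complex differentiability at every point of D, for D open: [derivable] in the
   direction 1 of R[i] as a one-dimensional normed space over itself. *)
Definition holomorphic_on (R : realType) (D : set R[i]) (f : R[i] -> R[i]) :=
  forall z, D z -> derivable (f : R[i]^o -> R[i]^o) z 1.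

(* Main.v *)
Require Import Defs.
From mathcomp Require Import measurable_realfun zify ring lra.

Set Implicit Arguments.
Unset Strict Implicit.
Unset Printing Implicit Defensive.

Local Open Scope classical_set_scope.
Local Open Scope ring_scope.
Local Open Scope complex_scope.

(* Cancelling 2 sinh (6 p u) turns the four hyperbolic quotients of the j-th
   coordinate into one kernel g_j, a signed sum of two quotients
   cosh (alpha u) / cosh (6 p u) with |alpha| < 6 p, so that up to elementary
   factors L_j(t) is the Gaussian transform of g_j at 12 p / t.

   The Fourier transform of cosh (alpha u) / cosh (6 p u) is computed in reverse:
   the real part of 1 / cosh (2 w + i s) has cosine transform
   (pi / 4) cosh (x s / 2) / cosh (pi x / 4) for |s| < pi / 2. Indeed, by the
   Cauchy-Riemann equations and integration by parts, this transform solves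
   A'' = (x / 2)^2 A in s, and its value is fixed by letting s tend to pi / 2,
   where the kernel concentrates at 0. Together with Fubini's theorem and the
   Fourier transform of complex Gaussians this replaces t by pi^2 / t and g_j by
   a dual kernel W_j. With th = pi j / p, a telescoping sum shows that
   W_j(w) = 2 sqrt 3 (sin th cosh 10 w - sin 5 th cosh 2 w) / (cosh 12 w + cos 6 th)
   is the combination of the g_k given by the j-th row of the mixing matrix. *)

(** No contour integral occurs. What residues would give is read off from differential equations: a
    linear system in the angle s for the hyperbolic kernel, one in the frequency for the complex
    Gaussian, and a vanishing complex derivative along a segment of the right half-plane for the
    Gauss integral itself. The first two rest on differentiation under the integral sign, so the
    kernels are bounded by multiples of e^-w uniformly in the parameter. This forces the angles to
    stay strictly between - pi / 2 and pi / 2. For 1 <= j <= (p - 1) / 2 that condition is |alpha| <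
    6 p, and it could fail only at 6 j = p, which is excluded because p is prime to 6.

    The scale 2 in 1 / cosh (2 w + i s) makes a frequency alpha correspond to the angle s = alpha pi
    / (12 p), and it sends the Gaussian parameter z = 12 p / t to (12 p / pi)^2 / z = 12 p / (pi^2 /
    t), which is the parameter of the same integrals at the dual point. The square roots are
    principal ones, and their signs are settled by the positivity of real parts. *)

Section RealDerivatives.
Variable R : realType.
Implicit Types (f g : R -> R) (x a b : R).

Lemma der_cst x (c : R) : is_derive x 1 (fun _ : R => c) 0.
Proof. exact: is_derive_cst. Qed.

Lemma der_id x : is_derive x 1 (fun y : R => y) 1.
Proof. exact: is_derive_id. Qed.

Lemma der_add f g x a b : is_derive x 1 f a -> is_derive x 1 g b ->
  is_derive x 1 (fun y => f y + g y) (a + b).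
Proof. by move=> df dg; apply: is_deriveD. Qed.

Lemma der_opp f x a : is_derive x 1 f a -> is_derive x 1 (fun y => - f y) (- a).
Proof. by move=> df; apply: is_deriveN. Qed.

Lemma der_mul f g x a b : is_derive x 1 f a -> is_derive x 1 g b ->
  is_derive x 1 (fun y => f y * g y) (f x * b + g x * a).
Proof. by move=> df dg; apply: is_deriveM. Qed.

Lemma der_inv f x a : f x != 0 -> is_derive x 1 f a ->
  is_derive x 1 (fun y => (f y)^-1) (- (f x ^- 2 * a)).
Proof.
by move=> fx0 df; apply: (is_derive_eq (is_deriveV fx0 df)); rewrite /GRing.scale /= mulNr.
Qed.

Lemma der_sqr f x a : is_derive x 1 f a ->
  is_derive x 1 (fun y => f y ^+ 2) (2 * f x * a).
Proof.
move=> df; have := der_mul df df.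
have -> : (fun y => f y * f y) = (fun y => f y ^+ 2) by apply/funext => y; rewrite expr2.
by move=> h; apply: (is_derive_eq h); ring.
Qed.

Lemma der_comp f g x a b : is_derive (g x) 1 f a -> is_derive x 1 g b ->
  is_derive x 1 (fun y => f (g y)) (a * b).
Proof. by move=> df dg; apply: (is_derive1_comp df dg). Qed.

Lemma der_exp g x b : is_derive x 1 g b ->
  is_derive x 1 (fun y => expR (g y)) (expR (g x) * b).
Proof. by move=> dg; apply: (der_comp (is_derive_expR _) dg). Qed.

Lemma der_sin g x b : is_derive x 1 g b ->
  is_derive x 1 (fun y => sin (g y)) (cos (g x) * b).
Proof. by move=> dg; apply: (der_comp (is_derive_sin _) dg). Qed.

Lemma der_cos g x b : is_derive x 1 g b ->
  is_derive x 1 (fun y => cos (g y)) (- sin (g x) * b).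
Proof. by move=> dg; apply: (der_comp (is_derive_cos _) dg). Qed.

Lemma is_derive_continuous f x a : is_derive x 1 f a -> {for x, continuous f}.
Proof. by move=> df; apply/differentiable_continuous/derivable1_diffP; case: df. Qed.

Lemma is_derive0_eq f a b : a <= b ->
  (forall x, a <= x <= b -> is_derive x 1 f 0) -> f a = f b.
Proof.
move=> ab df.
rewrite -(subKr (f b) (f a)).
have [||c _ ->] := @MVT_segment _ f (cst 0) a b ab; last by rewrite mul0r subr0.
  by move=> x; rewrite in_itv /= => /andP[/ltW ax /ltW xb]; apply: df; rewrite ax.
apply: derivable_within_continuous => x; rewrite in_itv /= => xab.
by case: (df _ xab).
Qed.

End RealDerivatives.

(** * Hyperbolic functions *)

Section Hyperbolic.
Variable R : realType.
Implicit Types (f : R -> R) (x y : R).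

Definition cosh (x : R) : R := (expR x + expR (- x)) / 2.

Lemma sqr_cosh x : cosh x ^+ 2 = 1 + sinh x ^+ 2.
Proof.
have h : expR x * expR (- x) = 1 by rewrite -expRD subrr expR0.
apply/subr0_eq; transitivity (expR x * expR (- x) - 1); last by rewrite h subrr.
by rewrite /cosh /sinh; field.
Qed.

Lemma der_cosh f (x : R) (a : R) : is_derive x 1 f a ->
  is_derive x 1 (fun y => cosh (f y)) (sinh (f x) * a).
Proof.
move=> df; have h := der_mul (der_add (der_exp df) (der_exp (der_opp df))) (der_cst x 2^-1).
by apply: (is_derive_eq h); rewrite /sinh; field.
Qed.

Lemma der_sinh f (x : R) (a : R) : is_derive x 1 f a ->
  is_derive x 1 (fun y => sinh (f y)) (cosh (f x) * a).
Proof.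
move=> df; have h := der_mul (der_add (der_exp df) (der_opp (der_exp (der_opp df)))) (der_cst x 2^-1).
by apply: (is_derive_eq h); rewrite /cosh; field.
Qed.

Lemma cosh_gt0 x : 0 < cosh x.
Proof. by rewrite divr_gt0 // addr_gt0 ?expR_gt0. Qed.

Lemma cosh_ge1 x : 1 <= cosh x.
Proof.
have : 1 ^+ 2 <= cosh x ^+ 2 by rewrite sqr_cosh expr1n lerDl sqr_ge0.
by rewrite ler_pXn2r // nnegrE // ltW // cosh_gt0.
Qed.

Lemma normr_sinh_le x : `|sinh x| <= cosh x.
Proof.
rewrite -[leRHS](ger0_norm (ltW (cosh_gt0 x))) -ler_sqr ?nnegrE ?normr_ge0//.
by rewrite !real_normK ?num_real // sqr_cosh lerDr.
Qed.

Lemma sinh_ge0 x : 0 <= x -> 0 <= sinh x.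
Proof.
by move=> x0; rewrite divr_ge0 // subr_ge0 ler_expR; lra.
Qed.

Lemma sinh0 : sinh (0 : R) = 0.
Proof. by rewrite /sinh oppr0 subrr mul0r. Qed.

Lemma invr_cosh_le x : (cosh x)^-1 <= 2 * expR (- x).
Proof.
rewrite -[leRHS]invrK lef_pV2 ?posrE ?cosh_gt0 ?invr_gt0 ?mulr_gt0 ?expR_gt0//.
rewrite invfM -expRN opprK mulrC ler_pM2r ?invr_gt0 // lerDl; exact: expR_ge0.
Qed.

Lemma coshN x : cosh (- x) = cosh x.
Proof. by rewrite /cosh opprK addrC. Qed.

Lemma sinhN x : sinh (- x) = - sinh x :> R.
Proof. by rewrite /sinh opprK; ring. Qed.

Lemma coshD x y : cosh (x + y) = cosh x * cosh y + sinh x * sinh y.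
Proof. by rewrite /cosh /sinh opprD !expRD; field. Qed.

Lemma sinhD x y : sinh (x + y) = sinh x * cosh y + cosh x * sinh y.
Proof. by rewrite /cosh /sinh opprD !expRD; field. Qed.

End Hyperbolic.

(* Computes the derivative of an explicit real function of one variable,
   leaving the value as an existential variable to be compared by [is_derive_eq]. *)
Ltac der_step :=
  lazymatch goal with
  | |- is_derive _ _ (fun y => y) _ => apply: der_id
  | |- is_derive _ _ (fun _ => ?c) _ => apply: der_cst
  | |- is_derive _ _ (fun y => @?f y + @?g y) _ => eapply (@der_add _ f g); der_step
  | |- is_derive _ _ (fun y => - @?f y) _ => eapply (@der_opp _ f); der_step
  | |- is_derive _ _ (fun y => @?f y * @?g y) _ => eapply (@der_mul _ f g); der_step
  | |- is_derive _ _ (fun y => (@?f y)^-1) _ => eapply (@der_inv _ f); [ | der_step]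
  | |- is_derive _ _ (fun y => (@?f y) ^+ 2) _ => eapply (@der_sqr _ f); der_step
  | |- is_derive _ _ (fun y => expR (@?f y)) _ => eapply (@der_exp _ f); der_step
  | |- is_derive _ _ (fun y => sin (@?f y)) _ => eapply (@der_sin _ f); der_step
  | |- is_derive _ _ (fun y => cos (@?f y)) _ => eapply (@der_cos _ f); der_step
  | |- is_derive _ _ (fun y => cosh (@?f y)) _ => eapply (@der_cosh _ f); der_step
  | |- is_derive _ _ (fun y => sinh (@?f y)) _ => eapply (@der_sinh _ f); der_step
  | |- _ => eauto
  end.
Ltac der := eapply is_derive_eq; [der_step | ].

(** * Integrals over the half-line of functions dominated by multiples of e^-w *)

Section HalfLine.
Variable R : realType.
Local Notation mu := (@lebesgue_measure R).
Local Notation Ioo := (`[(0:R), +oo[%classic).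
Implicit Types (f g F : R -> R) (K : R).

Lemma integral_expN : \int[mu]_(w in Ioo) expR (- w) = 1.
Proof.
pose F (w : R) := - expR (- w).
have d (x : R) : is_derive x 1 F (expR (- x)) by rewrite /F; der; ring.
rewrite (@Rintegral_ge0_continuous_FTC2y _ _ F 0 0).
- by rewrite /F oppr0 expR0; ring.
- by move=> x _; exact: expR_ge0.
- apply: continuous_subspaceT => x; apply: (@is_derive_continuous _ _ _ (- expR (-x))).
  by der; ring.
- by rewrite -oppr0; apply: cvgN; exact: cvgr_expR.
- by move=> x _; case: (d x).
- by apply: cvg_at_right_filter; exact: (is_derive_continuous (d 0)).
- by move=> x _; rewrite derive1E; case: (d x).
Qed.

Lemma integrable_expN : mu.-integrable Ioo (EFin \o (fun w => expR (- w))).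
Proof.
apply/integrableP; split.
  by apply/measurable_EFinP; apply: measurable_funTS; apply: measurableT_comp.
have := integral_expN; rewrite /Rintegral.
under [X in (X < _)%E]eq_integral do rewrite /= ger0_norm ?expR_ge0//.
case E : (integral _ _ _) => [r| |] //=; first by rewrite ltry.
by move=> /eqP; rewrite eq_sym oner_eq0.
Qed.

Lemma integrable_le_expN f K : measurable_fun Ioo f ->
  (forall w, 0 <= w -> `|f w| <= K * expR (- w)) ->
  mu.-integrable Ioo (EFin \o f).
Proof.
move=> mf fK.
have iK : mu.-integrable Ioo (fun w : R => K%:E * (expR (- w))%:E)%E.
  by apply: integrableZl => //; exact: integrable_expN.
apply: (le_integrable _ _ _ iK) => //; first exact/measurable_EFinP.
move=> x /=; rewrite in_itv/= andbT => x0.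
by rewrite lee_fin (le_trans (fK _ x0)) // ler_norm.
Qed.

Lemma integrable_scale_expN K : mu.-integrable Ioo (EFin \o (fun w => K * expR (- w))).
Proof.
apply: (@integrable_le_expN _ `|K|).
  by apply: measurable_funTS; apply: measurable_funM => //; apply: measurableT_comp.
by move=> w _; rewrite normrM (ger0_norm (expR_ge0 _)).
Qed.

Lemma continuous_measurable_Ioo f : (forall w, 0 <= w -> {for w, continuous f}) ->
  measurable_fun Ioo f.
Proof.
move=> cf; apply: subspace_continuous_measurable_fun => //.
apply: continuous_in_subspaceT => w; rewrite inE /= in_itv /= andbT; exact: cf.
Qed.

Lemma cvg_le_expN F K : (forall w, 0 <= w -> `|F w| <= K * expR (- w)) ->
  F w @[w --> +oo] --> (0 : R).
Proof.
move=> FK.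
apply: norm_cvg0.
apply: (@squeeze_cvgr _ _ _ _ (cst 0) (fun w => K * expR (- w))).
- near=> w; rewrite normr_ge0 /=; apply: FK; near: w; exact: nbhs_pinfty_ge.
- exact: cvg_cst.
- rewrite -(mulr0 K); apply: cvgM; [exact: cvg_cst|exact: cvgr_expR].
Unshelve. all: by end_near. Qed.

(* Adding K e^-w to f makes the integrand nonnegative, which is the case covered
   by the library form of the fundamental theorem on half-lines. *)
Lemma integral_derivative F f K :
  (forall w : R, is_derive w 1 F (f w)) ->
  (forall w, 0 <= w -> {for w, continuous f}) ->
  (forall w, 0 <= w -> `|F w| <= K * expR (- w)) ->
  (forall w, 0 <= w -> `|f w| <= K * expR (- w)) ->
  \int[mu]_(w in Ioo) f w = - F 0.
Proof.
move=> dF cf FK fK.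
have mI : measurable Ioo by [].
have if_ : mu.-integrable Ioo (EFin \o f).
  by apply: (integrable_le_expN _ fK); exact: continuous_measurable_Ioo.
have ie : mu.-integrable Ioo (EFin \o (fun w => K * expR (- w))).
  exact: integrable_scale_expN.
suff : \int[mu]_(w in Ioo) (f w + K * expR (- w)) = K - F 0.
  rewrite RintegralD // RintegralZl ?integral_expN ?mulr1 //; last exact: integrable_expN.
  by move=> h; apply: (addIr K); rewrite h addrC.
pose G w := F w - K * expR (- w).
have d (w : R) : is_derive w 1 G (f w + K * expR (- w)) by rewrite /G; der; ring.
rewrite (@Rintegral_ge0_continuous_FTC2y _ _ G 0 0).
- by rewrite /G oppr0 expR0; ring.
- by move=> x x0; have := fK _ x0; rewrite ler_norml => /andP[]; lra.
- apply: continuous_in_subspaceT => w; rewrite inE /= in_itv /= andbT => w0.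
  apply: cvgD; first exact: cf.
  have dK : is_derive w 1 (fun w => K * expR (- w)) (- (K * expR (-w))) by der; ring.
  exact: (is_derive_continuous dK).
- rewrite [X in _ --> X](_ : 0 = 0 - K * 0); last by ring.
  apply: cvgB; first exact: (cvg_le_expN FK).
  by apply: cvgM; [exact: cvg_cst|exact: cvgr_expR].
- by move=> x _; case: (d x).
- by apply: cvg_at_right_filter; exact: (is_derive_continuous (d 0)).
- by move=> x _; rewrite derive1E; case: (d x).
Qed.

End HalfLine.

Section UnderIntegral.
Variable R : realType.
Local Notation mu := (@lebesgue_measure R).
Local Notation Ioo := (`[(0:R), +oo[%classic).

(** Dominated differentiation, with a single constant K serving the integrand and its parameter
    derivative on a whole neighbourhood of [a]. *)
Lemma is_derive_integral (f f' : R -> R -> R) (a u v K : R) :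
  u < a < v ->
  (forall x, u < x < v -> measurable_fun Ioo (f x)) ->
  (forall x w, u < x < v -> 0 <= w -> `|f x w| <= K * expR (- w)) ->
  (forall x w : R, u < x < v -> 0 <= w -> is_derive x 1 (f^~ w) (f' x w)) ->
  (forall x w, u < x < v -> 0 <= w -> `|f' x w| <= K * expR (- w)) ->
  is_derive a 1 (fun x => \int[mu]_(w in Ioo) f x w) (\int[mu]_(w in Ioo) f' a w).
Proof.
move=> auv mf fK df f'K.
have itv x : `]u, v[%classic x -> u < x < v by rewrite /= in_itv.
have inI w : Ioo w -> 0 <= w by rewrite /= in_itv /= andbT.
have Ia : `]u, v[%classic a by rewrite /= in_itv.
have intf x : `]u, v[%classic x -> mu.-integrable Ioo (EFin \o f x).
  move=> /itv xuv; apply: (@integrable_le_expN _ _ K); first exact: mf.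
  by move=> w; exact: fK.
have df1 x w : `]u, v[%classic x -> Ioo w -> derivable (f^~ w) x 1.
  by move=> /itv xuv /inI w0; case: (df _ _ xuv w0).
have df2 x w : `]u, v[%classic x -> Ioo w -> partial1of2 f x w = f' x w.
  by move=> /itv xuv /inI w0; rewrite partial1of2E; case: (df _ _ xuv w0).
have K0 : 0 <= K.
  have := le_trans (normr_ge0 _) (fK _ 0 auv (lexx _)).
  by rewrite oppr0 expR0 mulr1.
have G0 w : 0 <= K * expR (- w) by rewrite mulr_ge0 ?expR_ge0.
have Gub x w : `]u, v[%classic x -> Ioo w -> `|partial1of2 f x w| <= K * expR (- w).
  by move=> xuv Iw; rewrite df2 //; apply: f'K; [exact: itv|exact: inI].
have mI : measurable Ioo by [].
have iG := @integrable_scale_expN R K.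
split.
  exact (@derivable_under_integral R _ _ mu f Ioo mI a u v Ia intf df1 _ G0 iG Gub).
rewrite -derive1E (@differentiation_under_integral R _ _ mu f Ioo mI a u v Ia intf df1 _ G0 iG Gub).
by apply: eq_Rintegral => w; rewrite inE => Iw; exact: df2.
Qed.

End UnderIntegral.

(** * The kernel 1 / cosh (2 w + i t): derivatives and uniform bounds *)

Section SechFourier.
Variable R : realType.
Local Notation mu := (@lebesgue_measure R).
Local Notation Ioo := (`[(0:R), +oo[%classic).
Implicit Types (x w t : R).

(** This is |cosh (2 w + i t)|^2. *)
Definition sech_den (t w : R) : R := sinh (2 * w) ^+ 2 + cos t ^+ 2.
(* Real and imaginary parts of 1 / cosh (2 w + i t), and their t-derivatives. *)
Definition sech_re (t w : R) : R := cosh (2 * w) * cos t / sech_den t w.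
Definition sech_im (t w : R) : R := - (sinh (2 * w) * sin t) / sech_den t w.
Definition sech_re' (t w : R) : R :=
  cosh (2 * w) * sin t * (cos t ^+ 2 - sinh (2 * w) ^+ 2) / sech_den t w ^+ 2.
Definition sech_im' (t w : R) : R :=
  - (sinh (2 * w) * cos t * (sinh (2 * w) ^+ 2 + cos t ^+ 2 + 2 * sin t ^+ 2))
   / sech_den t w ^+ 2.

Lemma sech_den_gt0 t w : 0 < cos t -> 0 < sech_den t w.
Proof.
by move=> c; rewrite /sech_den ltr_wpDl ?sqr_ge0 // exprn_gt0.
Qed.

(** Since k^2 <= cos^2 t <= 1, the factor k^2 can be charged to both terms of cosh^2 = 1 + sinh^2.
    The lower bound k on cos t, instead of cos t itself, keeps the later estimates uniform in t. *)
Lemma sech_den_ge t w (k : R) : 0 < k -> k <= cos t ->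
  k ^+ 2 * cosh (2 * w) ^+ 2 <= sech_den t w.
Proof.
move=> k0 kc; rewrite sqr_cosh /sech_den.
have h1 : k ^+ 2 <= cos t ^+ 2 by rewrite ler_sqr ?nnegrE //; lra.
have h2 : cos t ^+ 2 <= 1 by have := cos2Dsin2 t; have := sqr_ge0 (sin t); lra.
have := sqr_ge0 (sinh (2 * w)); nra.
Qed.

Lemma der_sech_re t w : 0 < cos t -> is_derive t 1 (sech_re ^~ w) (sech_re' t w).
Proof.
move=> c; have := sech_den_gt0 w c; rewrite /sech_re /sech_re' /sech_den => /lt0r_neq0 d.
by der => //; field.
Qed.

Lemma der_sech_im t w : 0 < cos t -> is_derive t 1 (sech_im ^~ w) (sech_im' t w).
Proof.
move=> c; have := sech_den_gt0 w c; rewrite /sech_im /sech_im' /sech_den => /lt0r_neq0 d.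
by der => //; field.
Qed.

(** This and the next lemma are the Cauchy-Riemann equations of a holomorphic function of 2 w + i t;
    the factor 2 is the scale of w. *)
Lemma derw_sech_im t w : 0 < cos t -> is_derive w 1 (sech_im t) (- 2 * sech_re' t w).
Proof.
move=> c; have := sech_den_gt0 w c; rewrite /sech_im /sech_re' /sech_den => /lt0r_neq0 d.
by der => //; field.
Qed.

Lemma derw_sech_re t w : 0 < cos t -> is_derive w 1 (sech_re t) (2 * sech_im' t w).
Proof.
move=> c; have := sech_den_gt0 w c; rewrite /sech_re /sech_im' /sech_den => /lt0r_neq0 d.
der => //.
have -> : sinh (2 * w) ^+ 2 + cos t ^+ 2 + 2 * sin t ^+ 2
  = 2 * cosh (2 * w) ^+ 2 - (sinh (2 * w) ^+ 2 + cos t ^+ 2).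
  by rewrite sqr_cosh; have := cos2Dsin2 t; lra.
by field.
Qed.

Lemma inv_cosh2_le w : 0 <= w -> (cosh (2 * w))^-1 <= 2 * expR (- w).
Proof.
move=> w0; apply: (le_trans (invr_cosh_le _)).
by rewrite ler_pM2l // ler_expR; lra.
Qed.

Section Bounds.
Variables (k t w : R).
Hypotheses (k0 : 0 < k) (kc : k <= cos t) (w0 : 0 <= w).
Let c := cosh (2 * w).
Let s := sinh (2 * w).
Let D := sech_den t w.

Let c0 : 0 < c. Proof. exact: cosh_gt0. Qed.
Let sc : `|s| <= c. Proof. exact: normr_sinh_le. Qed.
Let D0 : 0 < D. Proof. by apply: sech_den_gt0; exact: lt_le_trans kc. Qed.
Let Dge : k ^+ 2 * c ^+ 2 <= D. Proof. exact: sech_den_ge. Qed.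
Let ct1 : `|cos t| <= 1. Proof. by rewrite ler_norml cos_geN1 cos_le1. Qed.
Let st1 : `|sin t| <= 1. Proof. by rewrite ler_norml sin_geN1 sin_le1. Qed.

Let Dv0 : 0 <= D^-1. Proof. by rewrite invr_ge0 ltW. Qed.
Let Dv20 : 0 <= D ^- 2. Proof. by rewrite invr_ge0 exprn_ge0 // ltW. Qed.
Let kv0 : 0 <= k ^- 2. Proof. by rewrite invr_ge0 exprn_ge0 // ltW. Qed.
Let cv0 : 0 <= c^-1. Proof. by rewrite invr_ge0 ltW. Qed.

(** From D >= k^2 c^2 follows c / D <= k^-2 / c, and 1 / c decays like 2 e^-w. The four bounds below
    all reduce to this quotient. *)
Let cD : c / D <= (k ^- 2 * 2) * expR (- w).
Proof.
rewrite -mulrA; apply: (@le_trans _ _ (k ^- 2 * c^-1)); last first.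
  by rewrite ler_wpM2l //; exact: inv_cosh2_le.
rewrite ler_pdivrMr //.
apply: (@le_trans _ _ (k ^- 2 * c^-1 * (k ^+ 2 * c ^+ 2))).
  by rewrite le_eqVlt; apply/orP; left; apply/eqP; field; rewrite !gt_eqF.
by rewrite ler_wpM2l // mulr_ge0.
Qed.

Lemma sech_re_le : `|sech_re t w| <= (k ^- 2 * 2) * expR (- w).
Proof.
apply: le_trans cD; rewrite /sech_re -/c -/D 2!normrM (ger0_norm (ltW c0)).
rewrite [`|D^-1|]gtr0_norm ?invr_gt0 // ler_wpM2r //.
by rewrite ler_piMr // ltW.
Qed.

Lemma sech_im_le : `|sech_im t w| <= (k ^- 2 * 2) * expR (- w).
Proof.
apply: le_trans cD; rewrite /sech_im -/s -/D normrM normrN normrM.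
rewrite [`|D^-1|]gtr0_norm ?invr_gt0 // ler_wpM2r //.
by rewrite -[leRHS]mulr1 ler_pM.
Qed.

Lemma sech_re'_le : `|sech_re' t w| <= (k ^- 2 * 2) * expR (- w).
Proof.
apply: le_trans cD; rewrite /sech_re' -/c -/s -/D.
have -> : c / D = c * 1 * D / D ^+ 2 by field; rewrite gt_eqF.
rewrite normrM [`|_^-1|]gtr0_norm ?invr_gt0 ?exprn_gt0 //.
rewrite ler_wpM2r //.
rewrite 2!normrM (ger0_norm (ltW c0)); apply: ler_pM => //.
- by apply: mulr_ge0 => //; exact: ltW.
- by apply: ler_pM => //; exact: ltW.
rewrite ler_norml /D /sech_den -/s.
by apply/andP; split; have := sqr_ge0 s; have := sqr_ge0 (cos t); lra.
Qed.

(** The last factor of the numerator can exceed D; it is at most 2 c^2 <= 2 k^-2 D, whence the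
    additional constant. *)
Lemma sech_im'_le : `|sech_im' t w| <= (2 * k ^- 2 * (k ^- 2 * 2)) * expR (- w).
Proof.
rewrite -mulrA; apply: (@le_trans _ _ (2 * k ^- 2 * (c / D))); last first.
  by rewrite ler_wpM2l // mulr_ge0.
rewrite /sech_im' -/s -/D.
have -> : 2 * k ^- 2 * (c / D) = c * 1 * (2 * k ^- 2 * D) / D ^+ 2.
  by field; rewrite !gt_eqF.
rewrite normrM normrN [`|_^-1|]gtr0_norm ?invr_gt0 ?exprn_gt0 //.
rewrite ler_wpM2r //.
rewrite 2!normrM; apply: ler_pM => //.
- by apply: ler_pM.
rewrite ger0_norm; last by have := sqr_ge0 s; have := sqr_ge0 (cos t); have := sqr_ge0 (sin t); lra.
apply: (@le_trans _ _ (2 * c ^+ 2)).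
  rewrite sqr_cosh -/s.
  by have := cos2Dsin2 t; have := sqr_ge0 s; have := sqr_ge0 (cos t); lra.
rewrite -mulrA ler_pM2l // -ler_pdivrMl ?invr_gt0 ?exprn_gt0 //.
by rewrite invrK.
Qed.

End Bounds.

End SechFourier.

(** * The cosine transform of [sech_re] as the solution of a linear system in t *)

Section SechFourier.
Variable R : realType.
Local Notation mu := (@lebesgue_measure R).
Local Notation Ioo := (`[(0:R), +oo[%classic).
Implicit Types (x w t : R).

Lemma is_derive_measurable_Ioo (f : R -> R) :
  (forall w : R, 0 <= w -> exists d : R, is_derive w 1 f d) -> measurable_fun Ioo f.
Proof.
move=> df; apply: continuous_measurable_Ioo => w /df[d hd].
exact: is_derive_continuous hd.
Qed.

Lemma normrM_le1l (a b c : R) : `|a| <= 1 -> `|b| <= c -> `|a * b| <= c.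
Proof. by move=> a1 bc; rewrite normrM -[leRHS]mul1r ler_pM. Qed.

Lemma integrable_scale (f : R -> R) (c : R) :
  mu.-integrable Ioo (EFin \o f) -> mu.-integrable Ioo (EFin \o (fun w => c * f w)).
Proof. by move=> h; refine (integrableZl _ c h). Qed.

Lemma Rintegral_lin2 (f g : R -> R) (a b : R) :
  mu.-integrable Ioo (EFin \o f) -> mu.-integrable Ioo (EFin \o g) ->
  \int[mu]_(w in Ioo) (a * f w + b * g w) =
  a * \int[mu]_(w in Ioo) f w + b * \int[mu]_(w in Ioo) g w.
Proof.
by move=> hf hg; rewrite RintegralD ?RintegralZl //; exact: integrable_scale.
Qed.

(** The sine transform of the imaginary part, defined next, is the companion function that closes
    the first-order system in t. *)
Definition sech_cos_int x t := \int[mu]_(w in Ioo) (cos (x * w) * sech_re t w).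
Definition sech_sin_int x t := \int[mu]_(w in Ioo) (sin (x * w) * sech_im t w).

(** The midpoint of |t| and pi / 2 bounds an interval around t on which cos stays away from 0, as
    the uniform domination requires. *)
Lemma cos_nbhs_lbound t : `|t| < pi / 2 ->
  exists2 t1 : R, `|t| < t1 & exists2 k : R, 0 < k &
    forall y, - t1 < y < t1 -> k <= cos y.
Proof.
move=> ht; exists ((`|t| + pi / 2) / 2); first by lra.
exists (cos ((`|t| + pi / 2) / 2)).
  by apply: cos_gt0_pihalf; have := normr_ge0 t; have := pi_gt0 R; lra.
move=> y; rewrite -ltr_norml => hy; rewrite -(cos_norm y).
have := normr_ge0 y; have := normr_ge0 t; have := pi_gt0 R => ? ? ?.
rewrite leNgt ltr_cos ?in_itv /= -?leNgt //; try lra; apply/andP; split; lra.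
Qed.

Section Ode.
Variables x t : R.
Hypothesis ht : `|t| < pi / 2.

Let cost0 : 0 < cos t.
Proof. by apply: cos_gt0_pihalf; rewrite -ltr_norml. Qed.

(** Integration by parts: by Cauchy-Riemann the function f below is the w-derivative of cos (x w)
    [sech_im] t w, whose value at w = 0 vanishes since sinh 0 = 0. *)
Lemma integral_cos_sech_re' :
  \int[mu]_(w in Ioo) (cos (x * w) * sech_re' t w) = - (x / 2) * sech_sin_int x t.
Proof.
have [t1 tt1 [k k0 hk]] := cos_nbhs_lbound ht.
have kt : k <= cos t by apply: hk; rewrite -ltr_norml.
have mI : measurable Ioo by [].
set K := k ^- 2 * 2.
have i1 : mu.-integrable Ioo (EFin \o (fun w => cos (x * w) * sech_re' t w)).
  apply: (@integrable_le_expN _ _ K).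
    apply: is_derive_measurable_Ioo => w w0; rewrite /sech_re' /sech_den; eexists.
    by der_step; rewrite ?expf_neq0 // lt0r_neq0 // sech_den_gt0.
  by move=> w w0; apply: normrM_le1l; [exact: cos_max|exact: sech_re'_le].
have i2 : mu.-integrable Ioo (EFin \o (fun w => sin (x * w) * sech_im t w)).
  apply: (@integrable_le_expN _ _ K).
    apply: is_derive_measurable_Ioo => w w0; rewrite /sech_im /sech_den; eexists.
    by der_step; rewrite lt0r_neq0 // sech_den_gt0.
  by move=> w w0; apply: normrM_le1l; [exact: sin_max|exact: sech_im_le].
pose f w := (- x) * (sin (x * w) * sech_im t w) + (- 2) * (cos (x * w) * sech_re' t w).
have : \int[mu]_(w in Ioo) f w = - (cos (x * 0) * sech_im t 0).
  apply: (@integral_derivative _ (fun w => cos (x * w) * sech_im t w) f (`|x| * K + 2 * K));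
    rewrite /f.
  - by move=> w; have d := derw_sech_im w cost0; der; ring.
  - move=> w w0; rewrite /sech_re' /sech_im /sech_den; eapply is_derive_continuous.
    by der_step; rewrite ?expf_neq0 // lt0r_neq0 // sech_den_gt0.
  - move=> w w0; apply: (@le_trans _ _ (K * expR (- w))).
      by apply: normrM_le1l; [exact: cos_max|exact: sech_im_le].
    rewrite ler_wpM2r ?expR_ge0 //.
    have : 0 <= K by rewrite mulr_ge0 // invr_ge0 exprn_ge0 // ltW.
    by have := normr_ge0 x; nra.
  - move=> w w0; rewrite [leRHS]mulrDl -!(mulrA _ K); apply: (le_trans (ler_normD _ _)).
    apply: lerD; rewrite normrM normrN.
      apply: ler_wpM2l => //.
      by apply: normrM_le1l; [exact: sin_max|exact: sech_im_le].
    rewrite (ger0_norm (ler0n _ 2)); apply: ler_wpM2l => //.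
    by apply: normrM_le1l; [exact: cos_max|exact: sech_re'_le].
have im0 : sech_im t 0 = 0 by rewrite /sech_im mulr0 sinh0 mul0r oppr0 mul0r.
rewrite /f Rintegral_lin2 // im0 mulr0 oppr0 -/(sech_sin_int x t).
set I2 := Rintegral _ _ _ => h.
have e : 2 * I2 = - x * sech_sin_int x t by lra.
have -> : I2 = (2 * I2) / 2 by field.
by rewrite e; field.
Qed.

(** The same integration by parts for sin (x w) [sech_re] t w; here the boundary value vanishes
    because of the sine. *)
Lemma integral_sin_sech_im' :
  \int[mu]_(w in Ioo) (sin (x * w) * sech_im' t w) = - (x / 2) * sech_cos_int x t.
Proof.
have [t1 tt1 [k k0 hk]] := cos_nbhs_lbound ht.
have kt : k <= cos t by apply: hk; rewrite -ltr_norml.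
set K := k ^- 2 * 2; set K2 := 2 * k ^- 2 * (k ^- 2 * 2).
have kv0 : 0 <= k ^- 2 by rewrite invr_ge0 exprn_ge0 // ltW.
have K0 : 0 <= K by rewrite mulr_ge0.
have K20 : 0 <= K2 by rewrite mulr_ge0 // mulr_ge0.
have i1 : mu.-integrable Ioo (EFin \o (fun w => sin (x * w) * sech_im' t w)).
  apply: (@integrable_le_expN _ _ K2).
    apply: is_derive_measurable_Ioo => w w0; rewrite /sech_im' /sech_den; eexists.
    by der_step; rewrite ?expf_neq0 // lt0r_neq0 // sech_den_gt0.
  by move=> w w0; apply: normrM_le1l; [exact: sin_max|exact: sech_im'_le].
have i2 : mu.-integrable Ioo (EFin \o (fun w => cos (x * w) * sech_re t w)).
  apply: (@integrable_le_expN _ _ K).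
    apply: is_derive_measurable_Ioo => w w0; rewrite /sech_re /sech_den; eexists.
    by der_step; rewrite lt0r_neq0 // sech_den_gt0.
  by move=> w w0; apply: normrM_le1l; [exact: cos_max|exact: sech_re_le].
pose f w := x * (cos (x * w) * sech_re t w) + 2 * (sin (x * w) * sech_im' t w).
have : \int[mu]_(w in Ioo) f w = - (sin (x * 0) * sech_re t 0).
  apply: (@integral_derivative _ (fun w => sin (x * w) * sech_re t w) f
    (`|x| * K + (2 * K2 + K))); rewrite /f.
  - by move=> w; have d := derw_sech_re w cost0; der; ring.
  - move=> w w0; rewrite /sech_im' /sech_re /sech_den; eapply is_derive_continuous.
    by der_step; rewrite ?expf_neq0 // lt0r_neq0 // sech_den_gt0.
  - move=> w w0; apply: (@le_trans _ _ (K * expR (- w))).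
      by apply: normrM_le1l; [exact: sin_max|exact: sech_re_le].
    rewrite ler_wpM2r ?expR_ge0 //.
    by have := normr_ge0 x; nra.
  - move=> w w0; rewrite [leRHS]mulrDl -!(mulrA _ K); apply: (le_trans (ler_normD _ _)).
    apply: lerD; rewrite normrM.
      apply: ler_wpM2l => //.
      by apply: normrM_le1l; [exact: cos_max|exact: sech_re_le].
    rewrite (ger0_norm (ler0n _ 2)); apply: (@le_trans _ _ (2 * (K2 * expR (- w)))).
      apply: ler_wpM2l => //.
      by apply: normrM_le1l; [exact: sin_max|exact: sech_im'_le].
    by rewrite mulrA ler_wpM2r ?expR_ge0 // lerDl.
rewrite /f Rintegral_lin2 // mulr0 sin0 mul0r oppr0 -/(sech_cos_int x t).
set I2 := Rintegral _ _ _ => h.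
have e : 2 * I2 = - x * sech_cos_int x t by lra.
have -> : I2 = (2 * I2) / 2 by field.
by rewrite e; field.
Qed.

(** Differentiation under the integral followed by the integration by parts. Together with the next
    lemma, A = [sech_cos_int] x and B = [sech_sin_int] x satisfy A' = - (x / 2) B and B' = - (x / 2)
    A. *)
Lemma der_sech_cos_int : is_derive t 1 (sech_cos_int x) (- (x / 2) * sech_sin_int x t).
Proof.
rewrite -integral_cos_sech_re'.
have [t1 tt1 [k k0 hk]] := cos_nbhs_lbound ht.
have hc y : - t1 < y < t1 -> 0 < cos y by move=> /hk; exact: lt_le_trans.
apply: (@is_derive_integral R (fun t w => cos (x * w) * sech_re t w)
  (fun t w => cos (x * w) * sech_re' t w) t (- t1) t1 (k ^- 2 * 2)).
- by rewrite -ltr_norml.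
- move=> y /hc c0; apply: is_derive_measurable_Ioo => w w0; rewrite /sech_re /sech_den; eexists.
  by der_step; rewrite lt0r_neq0 // sech_den_gt0.
- by move=> y w /hk c0 w0; apply: normrM_le1l; [exact: cos_max|exact: sech_re_le].
- by move=> y w /hc c0 w0; have d := der_sech_re w c0; der; ring.
- by move=> y w /hk c0 w0; apply: normrM_le1l; [exact: cos_max|exact: sech_re'_le].
Qed.

Lemma der_sech_sin_int : is_derive t 1 (sech_sin_int x) (- (x / 2) * sech_cos_int x t).
Proof.
rewrite -integral_sin_sech_im'.
have [t1 tt1 [k k0 hk]] := cos_nbhs_lbound ht.
have hc y : - t1 < y < t1 -> 0 < cos y by move=> /hk; exact: lt_le_trans.
have kv0 : 0 <= k ^- 2 by rewrite invr_ge0 exprn_ge0 // ltW.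
(* One constant has to dominate both the integrand and its derivative, so their two bounds are
   added. *)
apply: (@is_derive_integral R (fun t w => sin (x * w) * sech_im t w)
  (fun t w => sin (x * w) * sech_im' t w) t (- t1) t1
  (k ^- 2 * 2 + 2 * k ^- 2 * (k ^- 2 * 2))).
- by rewrite -ltr_norml.
- move=> y /hc c0; apply: is_derive_measurable_Ioo => w w0; rewrite /sech_im /sech_den; eexists.
  by der_step; rewrite lt0r_neq0 // sech_den_gt0.
- move=> y w /hk c0 w0; apply: normrM_le1l; first exact: sin_max.
  apply: (le_trans (sech_im_le k0 c0 w0)).
  by rewrite ler_wpM2r ?expR_ge0 // lerDl !mulr_ge0.
- by move=> y w /hc c0 w0; have d := der_sech_im w c0; der; ring.
- move=> y w /hk c0 w0; apply: normrM_le1l; first exact: sin_max.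
  apply: (le_trans (sech_im'_le k0 c0 w0)).
  by rewrite ler_wpM2r ?expR_ge0 // lerDr !mulr_ge0.
Qed.

End Ode.

(** The system is diagonalised by A + B and A - B: the functions e^(x t / 2) (A + B) and e^(- x t /
    2) (A - B) are constant in t, and B vanishes at t = 0. *)
Lemma sech_cos_int_cosh x t : 0 <= t < pi / 2 ->
  sech_cos_int x t = sech_cos_int x 0 * cosh (x / 2 * t).
Proof.
move=> /andP[t0 t1].
have small y : 0 <= y <= t -> `|y| < pi / 2 by move=> /andP[? ?]; rewrite ger0_norm //; lra.
have B0 : sech_sin_int x 0 = 0.
  rewrite /sech_sin_int; under eq_Rintegral do rewrite /sech_im sin0 mulr0 oppr0 mul0r mulr0.
  by rewrite /Rintegral integral0.
have P1 : expR (x / 2 * 0) * (sech_cos_int x 0 + sech_sin_int x 0)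
   = expR (x / 2 * t) * (sech_cos_int x t + sech_sin_int x t).
  apply: (@is_derive0_eq _ (fun y => expR (x / 2 * y) * (sech_cos_int x y + sech_sin_int x y))) => //.
  move=> y /small hy.
  have dA := der_sech_cos_int x hy; have dB := der_sech_sin_int x hy.
  by der; ring.
have P2 : expR (- (x / 2 * 0)) * (sech_cos_int x 0 - sech_sin_int x 0)
   = expR (- (x / 2 * t)) * (sech_cos_int x t - sech_sin_int x t).
  apply: (@is_derive0_eq _ (fun y => expR (- (x / 2 * y)) * (sech_cos_int x y - sech_sin_int x y))) => //.
  move=> y /small hy.
  have dA := der_sech_cos_int x hy; have dB := der_sech_sin_int x hy.
  by der; ring.
move: P1 P2; rewrite B0 mulr0 oppr0 expR0 !mul1r !addr0.
set a := x / 2 * t; set A := sech_cos_int x t; set B := sech_sin_int x t => P1 P2.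
have e1 : expR (- a) * expR a = 1 by rewrite -expRD addNr expR0.
have Q1 : A + B = expR (- a) * sech_cos_int x 0 by rewrite P1 mulrA e1 mul1r.
have Q2 : A - B = expR a * sech_cos_int x 0.
  by rewrite P2 mulrA (mulrC (expR a)) e1 mul1r.
rewrite /cosh; have -> : A = ((A + B) + (A - B)) / 2 by field.
by rewrite Q1 Q2; field.
Qed.

End SechFourier.

(** * The constant of integration, from the limit of t at pi / 2 *)

Section SechFourierConstant.
Variable R : realType.
Local Notation mu := (@lebesgue_measure R).
Local Notation Ioo := (`[(0:R), +oo[%classic).
Implicit Types (x y w t : R).

Lemma normr_sin_le y : `|sin y| <= `|y|.
Proof.
wlog y0 : y / 0 <= y => [hw|].
  by have [/hw//|/ltW y0] := leP 0 y; rewrite -(normrN y) -(normrN (sin y)) -sinN; apply: hw; lra.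
have [c _] := @MVT_segment _ sin cos 0 y y0 (fun z _ => is_derive_sin z)
  (continuous_subspaceT (@continuous_sin R)).
rewrite sin0 !subr0 => ->; rewrite normrM -[leRHS]mul1r ler_wpM2r //; exact: cos_max.
Qed.

Lemma onem_cos_le y : 1 - cos y <= y ^+ 2 / 2.
Proof.
have -> : cos y = 1 - 2 * sin (y / 2) ^+ 2.
  rewrite -[in LHS](_ : y / 2 + y / 2 = y); last by field.
  by rewrite cosD; have := cos2Dsin2 (y / 2); lra.
have : sin (y / 2) ^+ 2 <= (y / 2) ^+ 2.
  rewrite -[X in X <= _]real_normK ?num_real // -[X in _ <= X]real_normK ?num_real //.
  by rewrite lerXn2r ?nnegrE ?normr_ge0 ?normr_sin_le.
by rewrite expr_div_n; lra.
Qed.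

Lemma sinh2_ge w : 0 <= w -> w <= sinh (2 * w).
Proof.
move=> w0; have h1 := expR_ge1Dx (2 * w); have p := expR_gt0 (2 * w).
have h2 : expR (2 * w) * expR (- (2 * w)) = 1 by rewrite -expRD subrr expR0.
have p2 := expR_gt0 (- (2 * w)).
suff : 2 * w <= expR (2 * w) - expR (- (2 * w)) by rewrite /sinh; lra.
by nra.
Qed.

Lemma normr_integral_le (f : R -> R) (K : R) : measurable_fun Ioo f ->
  (forall w, 0 <= w -> `|f w| <= K * expR (- w)) ->
  `|\int[mu]_(w in Ioo) f w| <= K.
Proof.
move=> mf fK.
have i := integrable_le_expN mf fK.
apply: (le_trans (le_normr_Rintegral _ i)) => //.
have -> : K = \int[mu]_(w in Ioo) (K * expR (- w)).
  by rewrite RintegralZl ?integral_expN ?mulr1 //; exact: integrable_expN.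
apply: le_Rintegral => //; last first.
- by move=> w; rewrite /= in_itv /= andbT; exact: fK.
- exact: integrable_scale_expN.
- apply: (@integrable_le_expN _ _ K); first exact: measurableT_comp.
  by move=> w w0; rewrite normr_id; exact: fK.
Qed.

(** The antiderivative atan (sinh (2 w) / cos t) / 2 grows from 0 to pi / 4. The total mass is thus
    the same for every t, which makes a concentration argument possible. *)
Lemma integral_sech_re t : `|t| < pi / 2 ->
  \int[mu]_(w in Ioo) sech_re t w = pi / 4.
Proof.
move=> ht; have c0 : 0 < cos t by apply: cos_gt0_pihalf; rewrite -ltr_norml.
pose F w := atan (sinh (2 * w) / cos t) / 2.
have d (w : R) : is_derive w 1 F (sech_re t w).
  have h : is_derive w 1 (fun w => sinh (2 * w) / cos t) (2 * cosh (2 * w) / cos t).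
    by der; ring.
  have h1 := @der_comp R atan (fun w => sinh (2 * w) / cos t) w _ _ (is_derive1_atan _) h.
  have h2 := der_mul h1 (der_cst w 2^-1).
  apply: (is_derive_eq h2).
  have := sech_den_gt0 w c0; rewrite /sech_re /sech_den => D0.
  by field; rewrite gt_eqF // gt_eqF // addrC.
rewrite (@Rintegral_ge0_continuous_FTC2y _ _ F 0 (pi / 4)).
- by rewrite /F mulr0 sinh0 mul0r atan0 mul0r subr0.
- move=> w w0; rewrite /sech_re mulr_ge0 ?invr_ge0 //; last by rewrite ltW // sech_den_gt0.
  by rewrite mulr_ge0 // ltW // cosh_gt0.
- apply: continuous_subspaceT => w; exact: (is_derive_continuous (derw_sech_re w c0)).
- rewrite [X in _ --> X](_ : pi / 4 = pi / 2 / 2); last by field.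
  apply: cvgM; last exact: cvg_cst.
  apply: (@cvg_comp _ _ _ (fun w : R => sinh (2 * w) / cos t) atan _ +oo); last exact: cvgy_atan.
  apply/cvgryPge => A; near=> w.
  have w0 : 0 <= w by near: w; exact: nbhs_pinfty_ge.
  have wA : A <= w by near: w; apply: nbhs_pinfty_ge; exact: num_real.
  have h : w * cos t <= sinh (2 * w).
    by apply: le_trans (sinh2_ge w0); apply: ler_piMr => //; exact: cos_le1.
  apply: (le_trans wA); move: h; rewrite -ler_pdivlMr //.
- by move=> w _; case: (d w).
- by apply: cvg_at_right_filter; exact: (is_derive_continuous (d 0)).
- by move=> w _; rewrite derive1E; case: (d w).
Unshelve. all: by end_near. Qed.

(* As t tends to pi / 2 the kernel sech_re concentrates at 0. *)
Lemma sech_cos_int_near x t : `|t| < pi / 2 ->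
  `|sech_cos_int x t - pi / 4| <= (x ^+ 2 / 2 + 2) * 2 * cos t.
Proof.
move=> ht; have c0 : 0 < cos t by apply: cos_gt0_pihalf; rewrite -ltr_norml.
have mr : measurable_fun Ioo (sech_re t).
  by apply: is_derive_measurable_Ioo => w _; exists (2 * sech_im' t w); exact: derw_sech_re.
have mc : measurable_fun Ioo (fun w => cos (x * w)).
  by apply: is_derive_measurable_Ioo => w _; eexists; der_step.
have bd w : 0 <= w -> `|sech_re t w| <= cos t ^- 2 * 2 * expR (- w).
  exact: sech_re_le.
rewrite /sech_cos_int -(integral_sech_re ht) -RintegralB //; last 2 first.
- apply: (@integrable_le_expN _ _ (cos t ^- 2 * 2)); first exact: measurable_funM.
  by move=> w w0; apply: normrM_le1l; [exact: cos_max|exact: bd].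
- exact: integrable_le_expN bd.
apply: normr_integral_le.
  by apply: measurable_funB => //; exact: measurable_funM.
move=> w w0; rewrite -{2}(mul1r (sech_re t w)) -mulrBl normrM.
have r0 : 0 <= sech_re t w.
  rewrite /sech_re mulr_ge0 ?invr_ge0 //; last by rewrite ltW // sech_den_gt0.
  by rewrite mulr_ge0 // ltW // cosh_gt0.
rewrite (ger0_norm r0) ler0_norm; last by rewrite subr_le0 cos_le1.
rewrite opprB.
set a := 1 - cos (x * w); set c := cosh (2 * w); set s := sinh (2 * w).
have a0 : 0 <= a by rewrite subr_ge0 cos_le1.
have a2 : a <= 2 by have := cos_geN1 (x * w); rewrite /a; lra.
have ax : a <= x ^+ 2 * w ^+ 2 / 2 by rewrite -exprMn; exact: onem_cos_le.
have ws : w ^+ 2 <= s ^+ 2 by rewrite lerXn2r ?nnegrE ?sinh2_ge // sinh_ge0 //; lra.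
have cc : c ^+ 2 = 1 + s ^+ 2 by exact: sqr_cosh.
have cp : 0 < c by exact: cosh_gt0.
have D0 := sech_den_gt0 w c0.
(* Write c^2 = 1 + s^2. The part a is at most x^2 w^2 / 2 <= x^2 s^2 / 2, and a s^2 <= 2 s^2; this
   is the origin of x^2 / 2 + 2. The factor s^2 is then absorbed by [sech_den], so that the factor
   cos t of the kernel survives in the bound. *)
have key : a * c ^+ 2 <= (x ^+ 2 / 2 + 2) * s ^+ 2.
  have h1 : x ^+ 2 * w ^+ 2 <= x ^+ 2 * s ^+ 2 by rewrite ler_wpM2l // sqr_ge0.
  have h2 : a * s ^+ 2 <= 2 * s ^+ 2 by rewrite ler_wpM2r // sqr_ge0.
  by rewrite cc; lra.
apply: (@le_trans _ _ ((x ^+ 2 / 2 + 2) * cos t * c^-1)); last first.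
  rewrite -mulrA -[leRHS]mulrA -[leRHS]mulrA; apply: ler_wpM2l.
    by have := sqr_ge0 x; lra.
  rewrite (mulrC 2) -mulrA; apply: ler_wpM2l; first exact: ltW.
  by rewrite mulrC; exact: inv_cosh2_le.
rewrite /sech_re -/c mulrA ler_pdivrMr //.
have -> : a * (c * cos t) = (cos t * c^-1) * (a * c ^+ 2) by field; rewrite gt_eqF.
have -> : (x ^+ 2 / 2 + 2) * cos t / c * sech_den t w =
  (cos t * c^-1) * ((x ^+ 2 / 2 + 2) * sech_den t w) by field; rewrite gt_eqF.
apply: ler_wpM2l; first by rewrite mulr_ge0 ?invr_ge0 // ltW.
apply: (le_trans key); apply: ler_wpM2l; first by have := sqr_ge0 x; lra.
by rewrite /sech_den lerDl sqr_ge0.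
Qed.

(** For 0 < t < pi / 2 the quantity A cosh (x t / 2) lies within a fixed multiple of cos t of pi /
    4, and cos t tends to 0 as t tends to pi / 2. *)
Lemma sech_cos_int0 x : sech_cos_int x 0 * cosh (x / 2 * (pi / 2)) = pi / 4.
Proof.
set A := sech_cos_int x 0.
pose C := (x ^+ 2 / 2 + 2) * 2.
(* The bound 0 is written as C cos (pi / 2), so that the goal becomes g (pi / 2) >= 0 and follows
   from g >= 0 to the left of pi / 2. *)
apply/eqP; rewrite -subr_eq0 -normr_le0 -[leRHS](mulr0 C) -(cos_pihalf R) -subr_ge0.
pose g t := C * cos t - `|A * cosh (x / 2 * t) - pi / 4|.
have cg : g t @[t --> (pi / 2)^'-] --> g (pi / 2).
  apply: cvg_at_left_filter; apply: cvgB.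
    by apply: cvgM; [exact: cvg_cst|exact: continuous_cos].
  apply: cvg_norm; apply: cvgB; last exact: cvg_cst.
  have dd : is_derive (pi / 2 : R) 1 (fun t => A * cosh (x / 2 * t))
     (A * (sinh (x / 2 * (pi / 2)) * (x / 2))) by der; ring.
  exact: (is_derive_continuous dd).
apply: (cvgr_to_ge cg); near=> t.
have t0 : 0 < t by near: t; apply: nbhs_left_gt; rewrite divr_gt0 ?pi_gt0.
have t1 : t < pi / 2 by near: t; exact: nbhs_left_lt.
have t01 : 0 <= t < pi / 2 by rewrite t1 ltW.
rewrite /g subr_ge0 /A -(sech_cos_int_cosh x t01).
by apply: sech_cos_int_near; rewrite gtr0_norm.
Unshelve. all: by end_near. Qed.

(** Both sides are even in t, which reduces the claim to t >= 0. *)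
Theorem sech_fourier x t : `|t| < pi / 2 ->
  \int[mu]_(w in Ioo) (cos (x * w) * sech_re t w) =
  pi / 4 * cosh (x / 2 * t) / cosh (x / 2 * (pi / 2)).
Proof.
move=> ht.
have -> : \int[mu]_(w in Ioo) (cos (x * w) * sech_re t w) = sech_cos_int x `|t|.
  by apply: eq_Rintegral => w _; rewrite /sech_re /sech_den cos_norm.
rewrite sech_cos_int_cosh ?normr_ge0 // -(sech_cos_int0 x).
have -> : cosh (x / 2 * `|t|) = cosh (x / 2 * t).
  by case: (ger0P t) => _ //; rewrite mulrN coshN.
by field; rewrite gt_eqF // cosh_gt0.
Qed.

End SechFourierConstant.

(** * Complex derivatives from quadratic remainders, and the complex exponential *)

Lemma is_derive_quadratic (K : numFieldType) (f : K -> K) (z d C e : K) :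
  0 < e -> 0 <= C ->
  (forall h, `|h| < e -> `|f (z + h) - f z - h * d| <= C * `|h| ^+ 2) ->
  is_derive z 1 (f : K^o -> K^o) d.
Proof.
move=> e0 C0 hf.
suff cv : h^-1 *: ((f \o shift z) (h *: (1 : K^o)) - f z) @[h --> (0:K)^'] --> (d : K^o).
  apply: DeriveDef; first by apply/cvg_ex; exists d.
  exact/cvg_lim.
apply/cvgrPdist_le => /= r r0; near=> h.
have h0 : h != 0 by near: h; exact: nbhs_dnbhs_neq.
have he : `|h| < e.
  by near: h; apply: dnbhs0_lt.
(* C may be 0, so the radius is divided by C + 1. *)
have hr : `|h| <= r / (C + 1).
  by near: h; apply: dnbhs0_le; rewrite divr_gt0 // ltr_wpDl.
have -> : d - h^-1 *: (f (h *: (1 : K^o) + z) - f z) = - (h^-1 * (f (z + h) - f z - h * d)).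
  by rewrite /GRing.scale /= mulr1 (addrC h); field.
rewrite normrN normrM normfV ler_pdivrMl ?normr_gt0 //.
apply: (le_trans (hf _ he)); rewrite expr2 mulrCA ler_wpM2l //.
have C1 : 0 < C + 1 by rewrite ltr_wpDl.
move: hr; rewrite ler_pdivlMr // mulrC; apply: le_trans.
by rewrite ler_wpM2r // lerDl.
Unshelve. all: by end_near. Qed.

Section ComplexExp.
Variable R : realType.
Local Notation C := R[i].
Local Notation Re := (@complex.Re R).
Local Notation Im := (@complex.Im R).
Implicit Types (z u : C) (x y : R).

Lemma ReD z u : Re (z + u) = Re z + Re u. Proof. by case: z u => [? ?] [? ?]. Qed.
Lemma ImD z u : Im (z + u) = Im z + Im u. Proof. by case: z u => [? ?] [? ?]. Qed.
Lemma ReN z : Re (- z) = - Re z. Proof. by case: z. Qed.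
Lemma ImN z : Im (- z) = - Im z. Proof. by case: z. Qed.
Lemma ReM z u : Re (z * u) = Re z * Re u - Im z * Im u.
Proof. by case: z u => [? ?] [? ?]. Qed.
Lemma ImM z u : Im (z * u) = Re z * Im u + Im z * Re u.
Proof. by case: z u => [? ?] [? ?]. Qed.
Lemma ReMr z x : Re (z * x%:C) = Re z * x.
Proof. by rewrite ReM /= mulr0 subr0. Qed.
Lemma ImMr z x : Im (z * x%:C) = Im z * x.
Proof. by rewrite ImM /= mulr0 add0r. Qed.
Lemma eqC z u : Re z = Re u -> Im z = Im u -> z = u.
Proof. by case: z u => [? ?] [? ?] /= -> ->. Qed.

Definition ReIm := (ReD, ImD, ReN, ImN, ReMr, ImMr, ReM, ImM).

Lemma cexpD z u : cexp (z + u) = cexp z * cexp u.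
Proof.
by apply: eqC; rewrite !ReIm /= !ReIm expRD ?cosD ?sinD; ring.
Qed.

Lemma cexp0 : cexp (0 : C) = 1.
Proof. by apply: eqC; rewrite /= expR0 ?cos0 ?sin0 mul1r. Qed.

Lemma normc_le z (a : R) : `|Re z| <= a -> `|Im z| <= a -> `|z| <= (2 * a)%:C.
Proof.
move=> h1 h2; have -> : z = (Re z)%:C + 'i * (Im z)%:C by exact: complexE.
apply: (le_trans (ler_normD _ _)); rewrite normrM.
have n (x : R) : `|x%:C| = (`|x|)%:C.
  by rewrite normc_def /= expr0n addr0 sqrtr_sqr.
have -> : `|'i : C| = 1 by rewrite normc_def /= expr0n /= add0r expr1n sqrtr1.
by rewrite mul1r !n -rmorphD lecR; lra.
Qed.

(** The modulus [|z|] is an element of R[i]; this copy in R lets it enter real inequalities. *)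
Definition nrm z : R := Re `|z|.

Lemma nrmE z : `|z| = (nrm z)%:C.
Proof. by rewrite /nrm normc_def. Qed.

Lemma nrm_ge0 z : 0 <= nrm z.
Proof. by rewrite -ler0c -nrmE. Qed.

Lemma Re_le_nrm z : `|Re z| <= nrm z.
Proof. by rewrite -lecR -nrmE normc_ge_Re. Qed.

Lemma Im_le_nrm z : `|Im z| <= nrm z.
Proof.
rewrite -lecR -nrmE normc_def lecR -sqrtr_sqr ler_wsqrtr //.
by rewrite lerDr sqr_ge0.
Qed.

(** Both signs of x follow from 1 + y <= e^y at y = x and y = - x, and so does the second-order
    bound after it. *)
Lemma expRB1_le x : `|expR x - 1| <= `|x| * expR `|x|.
Proof.
have h1 := expR_ge1Dx x; have h2 := expR_ge1Dx (- x).
have p := expR_gt0 x; have e : expR x * expR (- x) = 1 by rewrite -expRD subrr expR0.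
have [x0|x0] := ger0P x.
  rewrite ger0_norm; last by lra.
  by nra.
have h3 : 1 <= expR (- x) by lra.
rewrite ltr0_norm; last by rewrite subr_lt0 -expR0 ltr_expR.
by nra.
Qed.

Lemma expRB1x_le x : `|expR x - 1 - x| <= x ^+ 2 * expR `|x|.
Proof.
have h1 := expR_ge1Dx x; have h2 := expR_ge1Dx (- x).
have p := expR_gt0 x; have e : expR x * expR (- x) = 1 by rewrite -expRD subrr expR0.
rewrite ger0_norm; last by lra.
apply: (@le_trans _ _ (x * (expR x - 1))); first by nra.
apply: (le_trans (ler_norm _)); rewrite normrM -(real_normK (num_real x)) expr2 -mulrA.
by rewrite ler_wpM2l // expRB1_le.
Qed.

Lemma sinB_le y : `|sin y - y| <= y ^+ 2.
Proof.
wlog y0 : y / 0 <= y => [hw|].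
  have [/hw//|/ltW y0] := leP 0 y.
  rewrite -normrN opprB -sqrrN (_ : y - sin y = sin (- y) - (- y)); last first.
    by rewrite sinN; ring.
  by apply: hw; lra.
have d (z : R) : is_derive z 1 (fun y => sin y - y) (cos z - 1) by der; ring.
have [|c] := @MVT_segment _ (fun y => sin y - y) (fun a => cos a - 1) 0 y y0.
  by apply: continuous_subspaceT => a; exact: (is_derive_continuous (d a)).
rewrite in_itv /= => /andP[c0 cy]; rewrite sin0 !subr0 => ->.
have := onem_cos_le c; have := cos_le1 c; have := cos_geN1 c => k1 k2 k3.
rewrite normrM (ger0_norm y0) expr2 ler_wpM2r // ler0_norm ?subr_le0 // opprB.
(* The inequality 1 - cos c <= c comes from c^2 / 2 when c <= 2 and from the trivial bound 2
   otherwise. *)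
by apply: le_trans cy; have [?|?] := leP c 2; nra.
Qed.

(* Componentwise form of |e^z - 1 - z| <= C |z|^2 e^|z|. *)
Lemma cexp_remainder z (r : R) : `|Re z| <= r -> `|Im z| <= r ->
  `|Re (cexp z - 1 - z)| <= 2 * (r ^+ 2 * expR r) /\
  `|Im (cexp z - 1 - z)| <= 2 * (r ^+ 2 * expR r).
Proof.
case: z => x y /= xr yr.
have r0 : 0 <= r by apply: le_trans xr.
have ex : expR x <= expR r by rewrite ler_expR; apply: le_trans xr; exact: ler_norm.
have ex' : expR `|x| <= expR r by rewrite ler_expR.
have x2 : x ^+ 2 <= r ^+ 2 by rewrite -(real_normK (num_real x)) lerXn2r.
have y2 : y ^+ 2 <= r ^+ 2 by rewrite -(real_normK (num_real y)) lerXn2r.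
have E0 := expR_ge0 x; have E1 := expR_ge0 r; have E2 := expR_ge0 `|x|.
have r2 := sqr_ge0 r.
split.
  have -> : expR x * cos y - 1 - x = expR x * (cos y - 1) + (expR x - 1 - x) by ring.
  apply: (le_trans (ler_normD _ _)); rewrite mulr_natl mulr2n lerD //.
    rewrite normrM (ger0_norm E0) mulrC ler_pM // ler0_norm ?subr_le0 ?cos_le1 //.
    by rewrite opprB; apply: (le_trans (onem_cos_le y)); have := sqr_ge0 y; lra.
  by apply: (le_trans (expRB1x_le x)); rewrite ler_pM ?sqr_ge0.
have -> : expR x * sin y - 0 - y = expR x * (sin y - y) + (expR x - 1) * y by ring.
apply: (le_trans (ler_normD _ _)); rewrite mulr_natl mulr2n lerD //.
  rewrite normrM (ger0_norm E0) mulrC ler_pM //.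
  exact: le_trans (sinB_le y) y2.
rewrite normrM expr2 -mulrA mulrC ler_pM //.
by apply: (le_trans (expRB1_le x)); rewrite ler_pM.
Qed.

End ComplexExp.

(** * Complex-valued integrals over the half-line, taken componentwise *)

Section ComplexIntegral.
Variable R : realType.
Local Notation mu := (@lebesgue_measure R).
Local Notation Ioo := (`[(0:R), +oo[%classic).
Local Notation C := R[i].
Local Notation Re := (@complex.Re R).
Local Notation Im := (@complex.Im R).
Implicit Types (f g : R -> C) (z c : C).

Definition cintegrable f :=
  mu.-integrable Ioo (EFin \o (fun w => Re (f w))) /\
  mu.-integrable Ioo (EFin \o (fun w => Im (f w))).

Lemma eq_cintegral f g : (forall w, 0 <= w -> f w = g w) ->
  cintegral Ioo f = cintegral Ioo g.
Proof.
by move=> fg; rewrite /cintegral; congr (_ +i* _); apply: eq_Rintegral => w;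
  rewrite inE /= in_itv /= andbT => /fg ->.
Qed.

Lemma integrableD_fin (f g : R -> R) : mu.-integrable Ioo (EFin \o f) ->
  mu.-integrable Ioo (EFin \o g) -> mu.-integrable Ioo (EFin \o (fun w => f w + g w)).
Proof. by move=> hf hg; refine (integrableD _ hf hg). Qed.

Lemma cintegrable_ext f (f1 f2 : R -> R) :
  (forall w, Re (f w) = f1 w) -> (forall w, Im (f w) = f2 w) ->
  mu.-integrable Ioo (EFin \o f1) -> mu.-integrable Ioo (EFin \o f2) -> cintegrable f.
Proof. by move=> /funext h1 /funext h2; rewrite /cintegrable h1 h2. Qed.

Lemma cintegrableD f g : cintegrable f -> cintegrable g ->
  cintegrable (fun w => f w + g w).
Proof.
move=> [f1 f2] [g1 g2].
by apply: (cintegrable_ext (fun w => ReD _ _) (fun w => ImD _ _)); exact: integrableD_fin.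
Qed.

Lemma cintegralD f g : cintegrable f -> cintegrable g ->
  cintegral Ioo (fun w => f w + g w) = cintegral Ioo f + cintegral Ioo g.
Proof.
move=> [f1 f2] [g1 g2]; apply: eqC; rewrite ?ReD ?ImD /=.
  by under eq_Rintegral do rewrite ReD; rewrite RintegralD.
by under eq_Rintegral do rewrite ImD; rewrite RintegralD.
Qed.

Lemma cintegrableZ c f : cintegrable f -> cintegrable (fun w => c * f w).
Proof.
move=> [f1 f2].
have eRe w : Re (c * f w) = Re c * Re (f w) + (- Im c) * Im (f w) by rewrite ReM mulNr.
by apply: (cintegrable_ext eRe (fun w => ImM _ _)); apply: integrableD_fin;
  exact: integrable_scale.
Qed.

Lemma cintegralZ c f : cintegrable f ->
  cintegral Ioo (fun w => c * f w) = c * cintegral Ioo f.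
Proof.
move=> [f1 f2]; apply: eqC; rewrite ?ReM ?ImM /=.
  under eq_Rintegral do rewrite ReM -mulNr.
  by rewrite Rintegral_lin2 // mulNr.
by under eq_Rintegral do rewrite ImM; rewrite Rintegral_lin2.
Qed.

Lemma cintegrable0 : cintegrable (fun=> 0).
Proof. by split; exact: integrable0. Qed.

Lemma cintegral0 : cintegral Ioo (fun=> 0) = 0 :> C.
Proof. by apply: eqC; rewrite /= /Rintegral integral0. Qed.

Lemma cintegral_sum (T : Type) (s : seq T) (F : T -> R -> C) :
  (forall i, cintegrable (F i)) ->
  cintegrable (fun w => \sum_(i <- s) F i w) /\
  cintegral Ioo (fun w => \sum_(i <- s) F i w) = \sum_(i <- s) cintegral Ioo (F i).
Proof.
move=> iF; elim: s => [|a s [IH1 IH2]].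
  under eq_fun do rewrite big_nil.
  by rewrite big_nil; split; [exact: cintegrable0|exact: cintegral0].
under eq_fun do rewrite big_cons.
rewrite big_cons; split; first exact: cintegrableD.
by rewrite cintegralD // IH2.
Qed.

Lemma normc_cintegral_le f (K : R) :
  measurable_fun Ioo (fun w => Re (f w)) -> measurable_fun Ioo (fun w => Im (f w)) ->
  (forall w, 0 <= w -> `|Re (f w)| <= K * expR (- w)) ->
  (forall w, 0 <= w -> `|Im (f w)| <= K * expR (- w)) ->
  `|cintegral Ioo f| <= (2 * K)%:C.
Proof. by move=> m1 m2 h1 h2; apply: normc_le; exact: normr_integral_le. Qed.

End ComplexIntegral.

(** * Gaussian transforms on the right half-plane and their complex derivative *)

Section GaussTransform.
Variable R : realType.
Local Notation mu := (@lebesgue_measure R).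
Local Notation Ioo := (`[(0:R), +oo[%classic).
Local Notation C := R[i].
Local Notation Re := (@complex.Re R).
Local Notation Im := (@complex.Im R).
Implicit Types (g : R -> R) (z h : C) (a B : R).

Lemma exprn_le_expR (w : R) n : 0 <= w -> w ^+ n <= n`!%:R * expR w.
Proof.
move=> w0; case: n => [|n].
  by rewrite expr0 fact0 mul1r; have := expR_ge1Dx w; lra.
have := expR_ge1Dxn n w0.
have f0 : (0 : R) < (n.+1)`!%:R by rewrite ltr0n fact_gt0.
by move=> k; rewrite mulrC -ler_pdivrMr //; lra.
Qed.

(** Use w^n <= n! e^w and complete the square in - a w^2 + (B + 2) w, whose maximum is (B + 2)^2 /
    (4 a). Of the 2 added to B, one unit pays for w^n and the other leaves the decay e^-w. *)
Lemma gauss_dominated a B n : 0 < a ->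
  exists2 K : R, 0 <= K &
   forall w, 0 <= w -> w ^+ n * expR (- a * w ^+ 2) * expR (B * w) <= K * expR (- w).
Proof.
move=> a0; exists (n`!%:R * expR ((B + 2) ^+ 2 / (4 * a))).
  by rewrite mulr_ge0 ?expR_ge0.
move=> w w0; rewrite -mulrA.
apply: (@le_trans _ _ ((n`!%:R * expR w) * (expR (- a * w ^+ 2) * expR (B * w)))).
  by rewrite ler_wpM2r ?mulr_ge0 ?expR_ge0 // exprn_le_expR.
rewrite -!mulrA ler_wpM2l // -!expRD ler_expR -subr_ge0.
rewrite [X in 0 <= X](_ : _ = a * (w - (B + 2) / (2 * a)) ^+ 2); last first.
  by field; rewrite gt_eqF.
by rewrite mulr_ge0 ?sqr_ge0 // ltW.
Qed.

(** The rate B is left free: the class is then stable under multiplication by powers of w, and the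
    Gaussian absorbs any such growth. *)
Definition exp_bounded g := measurable_fun Ioo g /\
  exists G B, 0 <= G /\ forall w, 0 <= w -> `|g w| <= G * expR (B * w).

Lemma exp_bounded_bounded g (G : R) : measurable_fun Ioo g ->
  (forall w, 0 <= w -> `|g w| <= G) -> exp_bounded g.
Proof.
move=> mg gG; split => //; exists `|G|, 0; split => // w w0.
by rewrite mul0r expR0 mulr1 (le_trans (gG _ w0)) // ler_norm.
Qed.

Lemma exp_boundedX g n : exp_bounded g -> exp_bounded (fun w => w ^+ n * g w).
Proof.
move=> [mg [G [B [G0 gG]]]]; split.
  by apply: measurable_funM => //; apply: measurable_funTS; exact: exprn_measurable.
exists (n`!%:R * G), (1 + B); split; first by rewrite mulr_ge0.
move=> w w0; rewrite normrM mulrDl mul1r expRD mulrACA ler_pM //; last exact: gG.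
by rewrite ger0_norm ?exprn_ge0 // exprn_le_expR.
Qed.

Definition gauss_kernel z (w : R) : C := cexp (- z * (w ^+ 2)%:C).

Definition gauss_transform g z : C :=
  cintegral Ioo (fun w => gauss_kernel z w * (g w)%:C).

Lemma Re_gauss_kernel z w :
  Re (gauss_kernel z w) = expR (- Re z * w ^+ 2) * cos (- Im z * w ^+ 2).
Proof. by rewrite /gauss_kernel [LHS]/= -ReN -ImN -ReMr -ImMr. Qed.

Lemma Im_gauss_kernel z w :
  Im (gauss_kernel z w) = expR (- Re z * w ^+ 2) * sin (- Im z * w ^+ 2).
Proof. by rewrite /gauss_kernel [LHS]/= -ReN -ImN -ReMr -ImMr. Qed.

Lemma measurable_Re_gauss_kernel z : measurable_fun Ioo (fun w => Re (gauss_kernel z w)).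
Proof.
apply: is_derive_measurable_Ioo => w _; eexists.
by under eq_fun do rewrite Re_gauss_kernel; der_step.
Qed.

Lemma measurable_Im_gauss_kernel z : measurable_fun Ioo (fun w => Im (gauss_kernel z w)).
Proof.
apply: is_derive_measurable_Ioo => w _; eexists.
by under eq_fun do rewrite Im_gauss_kernel; der_step.
Qed.

Lemma normr_Re_gauss_kernel z w : `|Re (gauss_kernel z w)| <= expR (- Re z * w ^+ 2).
Proof.
by rewrite Re_gauss_kernel normrM (ger0_norm (expR_ge0 _)) ler_piMr ?expR_ge0 ?cos_max.
Qed.

Lemma normr_Im_gauss_kernel z w : `|Im (gauss_kernel z w)| <= expR (- Re z * w ^+ 2).
Proof.
by rewrite Im_gauss_kernel normrM (ger0_norm (expR_ge0 _)) ler_piMr ?expR_ge0 ?sin_max.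
Qed.

Lemma gauss_kernel_integrable g z : 0 < Re z -> exp_bounded g ->
  cintegrable (fun w => gauss_kernel z w * (g w)%:C).
Proof.
move=> z0 [mg [G [B [G0 gG]]]].
have [K K0 hK] := gauss_dominated B 0 z0.
have bd (f : R -> R) : measurable_fun Ioo f ->
  (forall w, `|f w| <= expR (- Re z * w ^+ 2)) ->
  mu.-integrable Ioo (EFin \o (fun w => f w * g w)).
  move=> mf hf; apply: (@integrable_le_expN _ _ (G * K)); first exact: measurable_funM.
  move=> w w0; rewrite normrM -mulrA.
  apply: (@le_trans _ _ (expR (- Re z * w ^+ 2) * (G * expR (B * w)))).
    by apply: ler_pM => //; exact: gG.
  rewrite mulrCA ler_wpM2l //; apply: le_trans (hK _ w0).
  by rewrite expr0 mul1r.
apply: (cintegrable_ext (fun w => ReMr _ _) (fun w => ImMr _ _)).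
  by apply: bd; [exact: measurable_Re_gauss_kernel|exact: normr_Re_gauss_kernel].
by apply: bd; [exact: measurable_Im_gauss_kernel|exact: normr_Im_gauss_kernel].
Qed.

(** The factor e^(- h w^2) - 1 + h w^2 is at most a multiple of |h|^2 w^4 e^(|h| w^2), so the
    remainder is quadratic in h as long as a part of the Gaussian is left to absorb it. *)
Lemma gauss_transform_is_derive g z : 0 < Re z -> exp_bounded g ->
  is_derive (z : C^o) 1 (gauss_transform g : C^o -> C^o)
    (- gauss_transform (fun w => w ^+ 2 * g w) z).
Proof.
move=> z0 eg; have [mg [G [B [G0 gG]]]] := eg.
have a0 : 0 < Re z / 2 by rewrite divr_gt0.
(* The power 4 comes from (|h| w^2)^2, and Re z / 2 is the decay that remains when |h| < Re z /
   2. *)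
have [K K0 hK] := gauss_dominated B 4 a0.
apply: (@is_derive_quadratic C _ z _ (2 * (4 * (G * K)))%:C (Re z / 2)%:C).
- by rewrite -[0]/(0%:C) ltcR.
- by rewrite ler0c !mulr_ge0.
move=> h; rewrite nrmE ltcR => hz.
have zh0 : 0 < Re (z + h).
  by have := Re_le_nrm h; rewrite ReD ler_norml => /andP[]; lra.
have i1 := gauss_kernel_integrable zh0 eg.
have i2 := gauss_kernel_integrable z0 eg.
have i3 := gauss_kernel_integrable z0 (exp_boundedX 2 eg).
have -> : gauss_transform g (z + h) - gauss_transform g z
   - h * - gauss_transform (fun w => w ^+ 2 * g w) z
  = cintegral Ioo (fun w => gauss_kernel z w *
     (cexp (- h * (w ^+ 2)%:C) - 1 - (- h * (w ^+ 2)%:C)) * (g w)%:C).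
  rewrite mulrN opprK -[X in _ - X]mul1r -mulNr /gauss_transform.
  rewrite -cintegralZ // -cintegralZ // -cintegralD //; last exact: cintegrableZ.
  rewrite -cintegralD //; last exact: cintegrableZ.
    apply: eq_cintegral => w w0.
    rewrite /gauss_kernel opprD mulrDl cexpD rmorphM /=; ring.
  by apply: cintegrableD => //; exact: cintegrableZ.
have n0 := nrm_ge0 h.
rewrite -rmorphXn -rmorphM.
have -> : 2 * (4 * (G * K)) * nrm h ^+ 2 = 2 * (4 * (G * K) * nrm h ^+ 2) by ring.
have mr (f : R -> C) : f = (fun w => cexp (- h * (w ^+ 2)%:C) - 1 - (- h * (w ^+ 2)%:C)) ->
   measurable_fun Ioo (fun w => Re (f w)) /\ measurable_fun Ioo (fun w => Im (f w)).
  move=> ->; split; apply: is_derive_measurable_Ioo => w _; eexists.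
    under eq_fun do rewrite !ReD !ReN !ReMr ReN -/(gauss_kernel h _) Re_gauss_kernel /=.
    by der_step.
  under eq_fun do rewrite !ImD !ImN !ImMr ImN -/(gauss_kernel h _) Im_gauss_kernel /=.
  by der_step.
have [mr1 mr2] := mr _ erefl.
(* The real and the imaginary part of kernel times remainder are both of the form p u + q v or p u -
   q v, so one estimate covers them. *)
have key (p q u v w : R) : 0 <= w ->
  `|p| <= expR (- Re z * w ^+ 2) -> `|q| <= expR (- Re z * w ^+ 2) ->
  `|u| <= 2 * ((nrm h * w ^+ 2) ^+ 2 * expR (nrm h * w ^+ 2)) ->
  `|v| <= 2 * ((nrm h * w ^+ 2) ^+ 2 * expR (nrm h * w ^+ 2)) ->
  (`|p * u| + `|q * v|) * `|g w| <= 4 * (G * K) * nrm h ^+ 2 * expR (- w).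
  move=> w0 hp hq hu hv; set b := 2 * _ in hu hv.
  set E := expR (- Re z * w ^+ 2) in hp hq.
  apply: (@le_trans _ _ ((E * b + E * b) * (G * expR (B * w)))).
    apply: ler_pM => //; last exact: gG.
    by apply: lerD; rewrite normrM; exact: ler_pM.
  have -> : (E * b + E * b) * (G * expR (B * w)) =
    (4 * G * nrm h ^+ 2) * (w ^+ 4 * (E * expR (nrm h * w ^+ 2)) * expR (B * w)).
    by rewrite /b; ring.
  have -> : 4 * (G * K) * nrm h ^+ 2 * expR (- w) = 4 * G * nrm h ^+ 2 * (K * expR (- w)).
    by ring.
  apply: ler_wpM2l; first by rewrite !mulr_ge0 ?sqr_ge0.
  apply: le_trans (hK w w0); rewrite ler_wpM2r ?expR_ge0 // ler_wpM2l ?exprn_ge0 //.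
  rewrite /E -expRD ler_expR -mulrDl ler_wpM2r ?sqr_ge0 //; lra.
have rem w : 0 <= w ->
  `|Re (cexp (- h * (w ^+ 2)%:C) - 1 - (- h * (w ^+ 2)%:C))|
     <= 2 * ((nrm h * w ^+ 2) ^+ 2 * expR (nrm h * w ^+ 2)) /\
  `|Im (cexp (- h * (w ^+ 2)%:C) - 1 - (- h * (w ^+ 2)%:C))|
     <= 2 * ((nrm h * w ^+ 2) ^+ 2 * expR (nrm h * w ^+ 2)).
  move=> w0; apply: cexp_remainder.
    by rewrite ReMr ReN normrM normrN (ger0_norm (sqr_ge0 w)) ler_wpM2r ?sqr_ge0 ?Re_le_nrm.
  by rewrite ImMr ImN normrM normrN (ger0_norm (sqr_ge0 w)) ler_wpM2r ?sqr_ge0 ?Im_le_nrm.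
pose e w := cexp (- h * (w ^+ 2)%:C) - 1 - (- h * (w ^+ 2)%:C).
pose f w := gauss_kernel z w * e w * (g w)%:C.
rewrite [cintegral _ _](_ : _ = cintegral Ioo f) //.
have fRe w : Re (f w) = (Re (gauss_kernel z w) * Re (e w) - Im (gauss_kernel z w) * Im (e w)) * g w.
  by rewrite /f ReMr ReM.
have fIm w : Im (f w) = (Re (gauss_kernel z w) * Im (e w) + Im (gauss_kernel z w) * Re (e w)) * g w.
  by rewrite /f ImMr ImM.
apply: normc_cintegral_le.
- rewrite (funext fRe).
  apply: measurable_funM => //; apply: measurable_funB; apply: measurable_funM => //.
    exact: measurable_Re_gauss_kernel.
  exact: measurable_Im_gauss_kernel.
- rewrite (funext fIm).
  apply: measurable_funM => //; apply: measurable_funD; apply: measurable_funM => //.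
    exact: measurable_Re_gauss_kernel.
  exact: measurable_Im_gauss_kernel.
- move=> w w0; have [r1 r2] := rem w w0.
  rewrite fRe normrM.
  apply: le_trans (key _ _ _ _ _ w0 (normr_Re_gauss_kernel z w) (normr_Im_gauss_kernel z w) r1 r2).
  by rewrite ler_wpM2r // ler_normB.
- move=> w w0; have [r1 r2] := rem w w0.
  rewrite fIm normrM.
  apply: le_trans (key _ _ _ _ _ w0 (normr_Re_gauss_kernel z w) (normr_Im_gauss_kernel z w) r2 r1).
  by rewrite ler_wpM2r // ler_normD.
Qed.

End GaussTransform.

(** * The principal square root, and complex functions with vanishing derivative *)

Lemma is_derive_remainder (K : numFieldType) (f : K -> K) (z d e : K) :
  is_derive z 1 (f : K^o -> K^o) d -> 0 < e ->
  exists2 r : K, 0 < r &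
    forall h, h != 0 -> `|h| < r -> `|f (z + h) - f z - h * d| <= e * `|h|.
Proof.
move=> [df dfE] e0.
have : h^-1 *: ((f \o shift z) (h *: (1 : K^o)) - f z) @[h --> (0:K)^'] --> (d : K^o).
  by rewrite -dfE; exact df.
move/cvgrPdist_le => /(_ _ e0) [r /= r0 hr].
exists r => // h h0 hlt.
have := hr h; rewrite /ball_ /= sub0r normrN => /(_ hlt h0).
have -> : d - h^-1 *: (f (h *: (1 : K^o) + z) - f z) = - (h^-1 * (f (z + h) - f z - h * d)).
  by rewrite /GRing.scale /= mulr1 (addrC h); field.
by rewrite normrN normrM normfV ler_pdivrMl ?normr_gt0 // (mulrC e).
Qed.

Section PrincipalRoot.
Variable R : realType.
Local Notation C := R[i].
Local Notation Re := (@complex.Re R).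
Local Notation Im := (@complex.Im R).
Implicit Types (z u : C).

Lemma Re_sqrtc_ge0 z : 0 <= Re (sqrtc z).
Proof. by case: z => a b /=; rewrite sqrtr_ge0. Qed.

Lemma Re_sqrtc_gt0 z : 0 < Re z -> 0 < Re (sqrtc z).
Proof.
by case: z => a b /= a0; rewrite sqrtr_gt0 divr_gt0 // ltr_wpDl // sqrtr_ge0.
Qed.

Lemma Re_gt0_neq0 z : 0 < Re z -> z != 0.
Proof. by move=> h; apply/eqP => e; move: h; rewrite e ltxx. Qed.

(** The only other root is - u, whose real part is negative, whereas [sqrtc] has nonnegative real
    part. This settles the choice of branch in the transformation law. *)
Lemma sqrtc_unique z u : u ^+ 2 = z -> 0 < Re u -> sqrtc z = u.
Proof.
move=> uz u0.
have : (sqrtc z - u) * (sqrtc z + u) = 0 by rewrite -subr_sqr sqr_sqrtc uz subrr.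
move/eqP; rewrite mulf_eq0 => /orP[|]; first by rewrite subr_eq0 => /eqP.
rewrite addr_eq0 => /eqP e; have := Re_sqrtc_ge0 z.
by rewrite e ReN oppr_ge0 leNgt u0.
Qed.

Lemma normc_ge_Re_gt0 u (m : R) : m <= Re u -> m%:C <= `|u|.
Proof.
move=> mu; apply: le_trans (normc_ge_Re u); rewrite lecR.
by apply: (le_trans mu); exact: ler_norm.
Qed.

(** With s = [sqrtc] z and s' = [sqrtc] (z + h) one has h = s'^2 - s^2, and the remainder is exactly
    - h^2 / (2 s (s' + s)^2). Its denominator is bounded below uniformly in h, because Re s' >= 0
    gives Re (s' + s) >= Re s > 0. *)
Lemma sqrtc_is_derive z : 0 < Re z ->
  is_derive (z : C^o) 1 (@sqrtc R : C^o -> C^o) (2 * sqrtc z)^-1.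
Proof.
move=> z0; set s := sqrtc z; set m := Re s.
have m0 : 0 < m by exact: Re_sqrtc_gt0.
have s0 : s != 0 by exact: Re_gt0_neq0.
have mC0 : 0 < m%:C by rewrite -[0]/(0%:C) ltcR.
apply: (@is_derive_quadratic C _ z _ ((2 * m%:C) * m%:C ^+ 2)^-1 1 ltr01).
  by rewrite invr_ge0 mulr_ge0 ?exprn_ge0 ?mulr_ge0 ?(ltW mC0).
move=> h _; set s' := sqrtc (z + h).
have hs : h = s' ^+ 2 - s ^+ 2 by rewrite !sqr_sqrtc; ring.
have ss : m <= Re (s' + s) by rewrite ReD lerDr Re_sqrtc_ge0.
have ss0 : s' + s != 0 by apply: Re_gt0_neq0; exact: lt_le_trans ss.
have -> : s' - s - h * (2 * s)^-1 = - (h ^+ 2 * (2 * s * (s' + s) ^+ 2)^-1).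
  by rewrite hs; field; rewrite ss0 s0.
rewrite normrN normrM normfV normrX mulrC ler_wpM2r ?exprn_ge0 //.
rewrite lef_pV2 ?posrE ?normr_gt0 ?mulf_neq0 ?expf_neq0 //; last first.
  by rewrite !mulr_gt0 ?exprn_gt0.
rewrite normrM normrM normrX normr_nat ler_pM ?ler_wpM2l //.
- by rewrite mulr_ge0 // ltW.
- by rewrite exprn_ge0 // ltW.
- exact: normc_ge_Re_gt0.
- by rewrite lerXn2r ?nnegrE ?normr_ge0 ?(ltW mC0) ?normc_ge_Re_gt0.
Qed.

(** P stands for the real or the imaginary part: being subtractive and dominated by the modulus, it
    passes from the complex difference quotient of f along the line to a real one. *)
Lemma derive0_line (f : C -> C) (a v : C) (r : R) (P : C -> R) :
  (forall u, `|P u| <= nrm u) -> (forall u1 u2, P (u1 - u2) = P u1 - P u2) ->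
  is_derive ((a + r%:C * v) : C^o) 1 (f : C^o -> C^o) 0 ->
  is_derive r 1 (fun s => P (f (a + s%:C * v))) 0.
Proof.
move=> Pn PB; set u := a + r%:C * v => df.
have [v0|v0] := eqVneq v 0.
  have -> : (fun s => P (f (a + s%:C * v))) = (fun=> P (f a)).
    by apply/funext => s; rewrite v0 mulr0 addr0.
  exact: der_cst.
have nv0 : 0 < nrm v by have := normr_gt0 v; rewrite v0 nrmE -[0]/(0%:C) ltcR.
suff cvr : h^-1 *: (((fun s : R => P (f (a + s%:C * v))) \o shift r) (h *: (1 : R^o))
    - P (f (a + r%:C * v))) @[h --> (0:R)^'] --> (0 : R^o).
  apply: DeriveDef; first by apply/cvg_ex; exists 0.
  exact/cvg_lim.
apply/cvgrPdist_le => /= e e0.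
have e1 : 0 < (e / nrm v)%:C :> C by rewrite -[0]/(0%:C) ltcR divr_gt0.
have [d d0 hd] := is_derive_remainder df e1.
(* A radius that is positive in the order of R[i] is a real number. *)
have dE : d = (Re d)%:C by rewrite (RRe_real (gtr0_real d0)).
have Rd0 : 0 < Re d by move: d0; rewrite dE -[0]/(0%:C) ltcR.
near=> h.
have h0 : h != 0 by near: h; exact: nbhs_dnbhs_neq.
have hd2 : `|h| < Re d / nrm v by near: h; apply: dnbhs0_lt; rewrite divr_gt0.
have hv0 : h%:C * v != 0 by rewrite mulf_neq0 // -[0]/(0%:C) (inj_eq (@complexI _)).
have nrmM (x : R) (y : C) : nrm (x%:C * y) = `|x| * nrm y.
  apply: (@complexI R); rewrite -nrmE normrM rmorphM /= -nrmE; congr (_ * _).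
  by rewrite normc_def /= expr0n addr0 sqrtr_sqr.
have := hd (h%:C * v) hv0; rewrite nrmE dE ltcR nrmM -ltr_pdivlMr // => /(_ hd2).
rewrite mulr0 subr0 nrmE -rmorphM lecR.
rewrite (_ : e / nrm v * (`|h| * nrm v) = e * `|h|); last by field; rewrite gt_eqF.
rewrite /GRing.scale /= !mulr1 !sub0r !normrN.
have -> : a + (h + r)%:C * v = u + h%:C * v by rewrite /u rmorphD /=; ring.
rewrite -PB normrM normfV -/u => hD.
rewrite ler_pdivrMl ?normr_gt0 // (mulrC `|h|).
exact: le_trans (Pn _) hD.
Unshelve. all: by end_near. Qed.

Lemma derive0_segment (f : C -> C) (a b : C) :
  (forall r : R, 0 <= r <= 1 -> is_derive ((a + r%:C * (b - a)) : C^o) 1 (f : C^o -> C^o) 0) ->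
  f a = f b.
Proof.
move=> df.
have e (P : C -> R) : (forall u, `|P u| <= nrm u) -> (forall u1 u2 : C, P (u1 - u2) = P u1 - P u2) ->
    P (f a) = P (f b).
  move=> P1 P2.
  have := @is_derive0_eq R (fun s => P (f (a + s%:C * (b - a)))) 0 1 ler01.
  rewrite mul0r mul1r addr0 (addrC a) subrK; apply.
  by move=> r /df; exact: derive0_line.
apply: eqC; apply: e.
- exact: Re_le_nrm.
- by move=> u1 u2; rewrite ReD ReN.
- exact: Im_le_nrm.
- by move=> u1 u2; rewrite ImD ImN.
Qed.

End PrincipalRoot.

(** * The Fourier transform of complex Gaussians *)

Section GaussFourier.
Variable R : realType.
Local Notation mu := (@lebesgue_measure R).
Local Notation Ioo := (`[(0:R), +oo[%classic).
Local Notation C := R[i].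
Local Notation Re := (@complex.Re R).
Local Notation Im := (@complex.Im R).
Implicit Types (g q : R -> R) (z : C).

Lemma Re_cintegral (f : R -> C) : Re (cintegral Ioo f) = \int[mu]_(w in Ioo) Re (f w).
Proof. by []. Qed.

Lemma Im_cintegral (f : R -> C) : Im (cintegral Ioo f) = \int[mu]_(w in Ioo) Im (f w).
Proof. by []. Qed.

(** Stated for an arbitrary real number f below the Gaussian, so that it applies to both components
    of [gauss_kernel]. *)
Lemma gauss_kernel_bound g z : 0 < Re z -> exp_bounded g ->
  exists2 K : R, 0 <= K & forall w f, 0 <= w -> `|f| <= expR (- Re z * w ^+ 2) ->
    `|f * g w| <= K * expR (- w).
Proof.
move=> z0 [mg [G [B [G0 gG]]]].
have [K K0 hK] := gauss_dominated B 0 z0.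
exists (G * K); first exact: mulr_ge0.
move=> w f w0 hf; rewrite normrM -mulrA.
apply: (@le_trans _ _ (expR (- Re z * w ^+ 2) * (G * expR (B * w)))).
  by apply: ler_pM => //; exact: gG.
rewrite mulrCA ler_wpM2l //; apply: le_trans (hK _ w0).
by rewrite expr0 mul1r.
Qed.

Lemma der_Re_gauss_kernel z (w : R) :
  is_derive w 1 (fun w => Re (gauss_kernel z w)) (Re (- (2 * w)%:C * (z * gauss_kernel z w))).
Proof.
under eq_fun do rewrite Re_gauss_kernel.
der; rewrite !ReIm Re_gauss_kernel Im_gauss_kernel /=; ring.
Qed.

Lemma der_Im_gauss_kernel z (w : R) :
  is_derive w 1 (fun w => Im (gauss_kernel z w)) (Im (- (2 * w)%:C * (z * gauss_kernel z w))).
Proof.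
under eq_fun do rewrite Im_gauss_kernel.
der; rewrite !ReIm Re_gauss_kernel Im_gauss_kernel /=; ring.
Qed.

(** The derivative of e^(- z w^2) q is e^(- z w^2) (q' - 2 z w q), and the product tends to 0 at
    infinity; the argument is carried out for each component. *)
Lemma gauss_by_parts q q' z : 0 < Re z -> exp_bounded q -> exp_bounded q' ->
  (forall w : R, is_derive w 1 q (q' w)) -> continuous q' ->
  gauss_transform q' z = 2 * z * gauss_transform (fun w => w * q w) z - (q 0)%:C.
Proof.
move=> z0 eq eq' dq cq'.
have eqw : exp_bounded (fun w => w * q w) by exact: (exp_boundedX 1 eq).
have i1 := gauss_kernel_integrable z0 eq'.
have i2 := gauss_kernel_integrable z0 eqw.
suff : cintegral Ioo (fun w => gauss_kernel z w * (q' w)%:C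
    + (- (2 * z)) * (gauss_kernel z w * (w * q w)%:C)) = - (q 0)%:C.
  rewrite cintegralD //; last exact: cintegrableZ.
  rewrite cintegralZ // -/(gauss_transform q' z) -/(gauss_transform (fun w => w * q w) z).
  by move/eqP; rewrite mulNr subr_eq => /eqP ->; ring.
have [K1 K10 hK1] := gauss_kernel_bound z0 eq.
have [K2 K20 hK2] := gauss_kernel_bound z0 eq'.
have [K3 K30 hK3] := gauss_kernel_bound z0 eqw.
pose K := K1 + (K2 + 2 * (`|Re z| + `|Im z|) * K3).
have cq : forall w : R, {for w, continuous q} by move=> w; exact: (is_derive_continuous (dq w)).
have bK (f0 f1 : R) (w : R) : 0 <= w -> `|f0| <= expR (- Re z * w ^+ 2) ->
   `|f1| <= expR (- Re z * w ^+ 2) -> forall (c0 c1 : R), `|c0| <= 2 * `|Re z| -> `|c1| <= 2 * `|Im z| ->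
   `|f0 * q' w + (c0 * (f0 * (w * q w)) + c1 * (f1 * (w * q w)))| <= K * expR (- w).
  move=> w0 hf0 hf1 c0 c1 hc0 hc1.
  have h2 := hK2 w f0 w0 hf0; have h3 := hK3 w f0 w0 hf0; have h4 := hK3 w f1 w0 hf1.
  apply: (le_trans (ler_normD _ _)).
  apply: (@le_trans _ _ (K2 * expR (- w) +
      (2 * `|Re z| * (K3 * expR (- w)) + 2 * `|Im z| * (K3 * expR (- w))))).
    apply: lerD => //; apply: (le_trans (ler_normD _ _)).
    by apply: lerD; rewrite normrM; apply: ler_pM.
  rewrite /K; have := expR_ge0 (- w) => E0.
  have : 0 <= K1 * expR (- w) by rewrite mulr_ge0.
  by lra.
have bF (f : R) (w : R) : 0 <= w -> `|f| <= expR (- Re z * w ^+ 2) ->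
   `|f * q w| <= K * expR (- w).
  move=> w0 hf; apply: (le_trans (hK1 w f w0 hf)).
  by rewrite ler_wpM2r ?expR_ge0 // lerDl addr_ge0 // mulr_ge0 // mulr_ge0 // addr_ge0.
have c2 : `|2 * Re z| <= 2 * `|Re z| by rewrite normrM (ger0_norm (ler0n _ 2)).
have c2' : `|- (2 * Re z)| <= 2 * `|Re z| by rewrite normrN.
have c3 : `|2 * Im z| <= 2 * `|Im z| by rewrite normrM (ger0_norm (ler0n _ 2)).
have c3' : `|- (2 * Im z)| <= 2 * `|Im z| by rewrite normrN.
have cRe (w : R) : {for w, continuous (fun w => Re (gauss_kernel z w))}.
  exact: (is_derive_continuous (der_Re_gauss_kernel z w)).
have cIm (w : R) : {for w, continuous (fun w => Im (gauss_kernel z w))}.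
  exact: (is_derive_continuous (der_Im_gauss_kernel z w)).
apply: eqC; rewrite /= ?ReN ?ImN /=.
- pose f w := Re (gauss_kernel z w) * q' w + (- (2 * Re z) * (Re (gauss_kernel z w) * (w * q w))
    + 2 * Im z * (Im (gauss_kernel z w) * (w * q w))).
  have -> : \int[mu]_(w in Ioo) Re (gauss_kernel z w * (q' w)%:C +
      - (2 * z) * (gauss_kernel z w * (w * q w)%:C)) = \int[mu]_(w in Ioo) f w.
    by apply: eq_Rintegral => w _; rewrite /f !ReIm /=; ring.
  have -> : \int[mu]_(w in Ioo) f w = - (Re (gauss_kernel z 0) * q 0); last first.
    by rewrite Re_gauss_kernel expr0n /= !mulr0 expR0 cos0 !mul1r.
  apply: (@integral_derivative _ (fun w => Re (gauss_kernel z w) * q w) f K).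
  + move=> w; have d1 := der_Re_gauss_kernel z w; have d2 := dq w.
    by der; rewrite /f !ReIm /=; ring.
  + move=> w w0; apply: cvgD; first by apply: cvgM; [exact: cRe|exact: cq'].
    by apply: cvgD; (apply: cvgM; [exact: cvg_cst|apply: cvgM]);
      [exact: cRe|apply: cvgM; [exact: cvg_id|exact: cq]|exact: cIm
      |apply: cvgM; [exact: cvg_id|exact: cq]].
  + by move=> w w0; apply: bF => //; exact: normr_Re_gauss_kernel.
  + move=> w w0; apply: bK => //; [exact: normr_Re_gauss_kernel|exact: normr_Im_gauss_kernel].
- pose f w := Im (gauss_kernel z w) * q' w + (- (2 * Re z) * (Im (gauss_kernel z w) * (w * q w))
    + - (2 * Im z) * (Re (gauss_kernel z w) * (w * q w))).
  have -> : \int[mu]_(w in Ioo) Im (gauss_kernel z w * (q' w)%:C +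
      - (2 * z) * (gauss_kernel z w * (w * q w)%:C)) = \int[mu]_(w in Ioo) f w.
    by apply: eq_Rintegral => w _; rewrite /f !ReIm /=; ring.
  have -> : \int[mu]_(w in Ioo) f w = - (Im (gauss_kernel z 0) * q 0); last first.
    by rewrite Im_gauss_kernel expr0n /= !mulr0 expR0 sin0 mulr0 mul0r.
  apply: (@integral_derivative _ (fun w => Im (gauss_kernel z w) * q w) f K).
  + move=> w; have d1 := der_Im_gauss_kernel z w; have d2 := dq w.
    by der; rewrite /f !ReIm /=; ring.
  + move=> w w0; apply: cvgD; first by apply: cvgM; [exact: cIm|exact: cq'].
    by apply: cvgD; (apply: cvgM; [exact: cvg_cst|apply: cvgM]);
      [exact: cIm|apply: cvgM; [exact: cvg_id|exact: cq]|exact: cRe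
      |apply: cvgM; [exact: cvg_id|exact: cq]].
  + by move=> w w0; apply: bF => //; exact: normr_Im_gauss_kernel.
  + move=> w w0; apply: bK => //; [exact: normr_Im_gauss_kernel|exact: normr_Re_gauss_kernel].
Qed.

Lemma exp_bounded1 : exp_bounded (fun _ : R => 1).
Proof. by apply: (@exp_bounded_bounded _ _ 1) => // w _; rewrite normr1. Qed.

Lemma exp_bounded_cos (b : R) : exp_bounded (fun w => cos (b * w)).
Proof.
apply: (@exp_bounded_bounded _ _ 1); last by move=> w _; exact: cos_max.
by apply: is_derive_measurable_Ioo => w _; eexists; der_step.
Qed.

Lemma exp_bounded_sin (b : R) : exp_bounded (fun w => sin (b * w)).
Proof.
apply: (@exp_bounded_bounded _ _ 1); last by move=> w _; exact: sin_max.
by apply: is_derive_measurable_Ioo => w _; eexists; der_step.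
Qed.

(** By parts, the transform of w^2 at u is 1 / (2 u) times that of 1. Hence the product of the
    transform of 1 with [sqrtc] has derivative 0 along the segment from 1 to z, and its value at 1
    is the real Gauss integral. *)
Lemma gauss_transform1 z : 0 < Re z ->
  gauss_transform (fun=> 1) z = (Num.sqrt pi / 2)%:C / sqrtc z.
Proof.
move=> z0; pose f (u : C) := gauss_transform (fun=> 1) u * sqrtc u.
have f1 : f 1 = (Num.sqrt pi / 2)%:C.
  rewrite /f sqrtc1 mulr1 /gauss_transform.
  have h := @integral0y_gauss R.
  apply: eqC.
    transitivity (\int[mu]_(w in Ioo) gauss_fun w); last by rewrite /Rintegral h.
    rewrite Re_cintegral; apply: eq_Rintegral => w _.
    by rewrite ReMr Re_gauss_kernel /= oppr0 mul0r cos0 !mulr1 mulN1r.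
  transitivity (\int[mu]_(w in Ioo) (0 : R)); last by rewrite /Rintegral integral0.
  rewrite Im_cintegral; apply: eq_Rintegral => w _.
  by rewrite ImMr Im_gauss_kernel /= oppr0 mul0r sin0 mulr0 mul0r.
suff e : f 1 = f z.
  by rewrite -f1 e /f mulfK //; apply: Re_gt0_neq0; exact: Re_sqrtc_gt0.
apply: derive0_segment => r /andP[r0 r1].
set u := 1 + r%:C * (z - 1).
have u0 : 0 < Re u.
  rewrite /u !ReIm /= mul0r subr0.
  have [->|rp] := eqVneq r 0; first by lra.
  have : 0 < r * Re z by rewrite mulr_gt0 // lt_neqAle eq_sym rp.
  by lra.
have s0 : sqrtc u != 0 by apply: Re_gt0_neq0; exact: Re_sqrtc_gt0.
have d1 := gauss_transform_is_derive u0 exp_bounded1.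
have d2 := sqrtc_is_derive u0.
have ibp : gauss_transform (fun=> 1) u =
   2 * u * gauss_transform (fun w => w ^+ 2 * 1) u.
  have := @gauss_by_parts (fun w => w) (fun=> 1) u u0 _ exp_bounded1.
  rewrite (_ : (0%:C : C) = 0) // subr0.
  rewrite (_ : (fun w : R => w * w) = (fun w => w ^+ 2 * 1)); last first.
    by apply/funext => w; rewrite mulr1 expr2.
  apply.
  - have := exp_boundedX 1 exp_bounded1.
    by rewrite (_ : (fun w : R => w ^+ 1 * 1) = (fun w => w)) //; apply/funext => w; rewrite mulr1 expr1.
  - by move=> w; exact: cvg_cst.
have d := is_deriveM d1 d2.
apply: (is_derive_eq d); rewrite /GRing.scale /= ibp -{1}(sqr_sqrtc u).
by field.
Qed.

(** As a function of the frequency b the transform G satisfies G' = - b / (2 z) G, by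
    differentiation under the integral and integration by parts, so G (b) e^(b^2 / (4 z)) is
    constant. Since b is real and G complex, the equation is handled as a real system with
    coefficients r and s, the components of 1 / z. *)
Theorem gauss_fourier z (b : R) : 0 < Re z ->
  gauss_transform (fun w => cos (b * w)) z =
  (Num.sqrt pi / 2)%:C / sqrtc z * cexp (- (b ^+ 2 / 4)%:C / z).
Proof.
move=> z0; rewrite -gauss_transform1 //.
pose G b := gauss_transform (fun w => cos (b * w)) z.
pose v := z^-1; pose r := Re v; pose s := Im v.
have z0' : z != 0 by exact: Re_gt0_neq0.
have ode (a : R) : - gauss_transform (fun w => w * sin (a * w)) z = - (a / 2)%:C * (v * G a).
  have := @gauss_by_parts (fun w => sin (a * w)) (fun w => a * cos (a * w)) z z0.
  rewrite mulr0 sin0 subr0 => h.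
  have e1 : gauss_transform (fun w => a * cos (a * w)) z = a%:C * G a.
    rewrite /G /gauss_transform -cintegralZ; last first.
      exact: gauss_kernel_integrable z0 (exp_bounded_cos a).
    by apply: eq_cintegral => w _; rewrite rmorphM /=; ring.
  have e2 : a%:C * G a = 2 * z * gauss_transform (fun w => w * sin (a * w)) z.
    rewrite -e1; apply: h.
    - exact: exp_bounded_sin.
    - apply: (@exp_bounded_bounded _ _ `|a|).
        by apply: is_derive_measurable_Ioo => w _; eexists; der_step.
      by move=> w _; rewrite normrM ler_piMr // cos_max.
    - by move=> w; der; ring.
    - move=> w; eapply is_derive_continuous; der_step.
  have e3 : gauss_transform (fun w => w * sin (a * w)) z = (2 * z)^-1 * (a%:C * G a).
    by rewrite e2 mulKf // mulf_neq0 // pnatr_eq0.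
  rewrite e3 /v rmorphM /= fmorphV rmorph_nat; field; exact: z0'.
have dG (a : R) (k : R -> R) : (forall w, `|k w| <= expR (- Re z * w ^+ 2)) ->
  measurable_fun Ioo k ->
  is_derive a 1 (fun b => \int[mu]_(w in Ioo) (k w * cos (b * w)))
    (\int[mu]_(w in Ioo) (k w * (- (w * sin (a * w))))).
  move=> hk mk.
  have [K1 K10 hK1] := gauss_kernel_bound z0 exp_bounded1.
  have [K2 K20 hK2] := gauss_kernel_bound z0 (exp_boundedX 1 exp_bounded1).
  apply: (@is_derive_integral R (fun b w => k w * cos (b * w))
     (fun b w => k w * (- (w * sin (b * w)))) a (a - 1) (a + 1) (K1 + K2)).
  - by apply/andP; split; lra.
  - move=> x _; apply: measurable_funM => //.
    by apply: is_derive_measurable_Ioo => w _; eexists; der_step.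
  - move=> x w _ w0; rewrite mulrC; apply: normrM_le1l; first exact: cos_max.
    have := hK1 w (k w) w0 (hk w); rewrite mulr1 => h; apply: (le_trans h).
    by rewrite ler_wpM2r ?expR_ge0 // lerDl.
  - by move=> x w _ w0; der; ring.
  - move=> x w _ w0; rewrite (_ : k w * - (w * sin (x * w)) = - sin (x * w) * (k w * w)); last by ring.
    apply: normrM_le1l; first by rewrite normrN sin_max.
    have := hK2 w (k w) w0 (hk w); rewrite expr1 mulr1 => h; apply: (le_trans h).
    by rewrite ler_wpM2r ?expR_ge0 // lerDr.
have GRe (a : R) : Re (G a) = \int[mu]_(w in Ioo) (Re (gauss_kernel z w) * cos (a * w)).
  by apply: eq_Rintegral => w _; rewrite ReMr.
have GIm (a : R) : Im (G a) = \int[mu]_(w in Ioo) (Im (gauss_kernel z w) * cos (a * w)).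
  by apply: eq_Rintegral => w _; rewrite ImMr.
have iS (a : R) : cintegrable (fun w => gauss_kernel z w * (w * sin (a * w))%:C).
  by apply: gauss_kernel_integrable => //; exact: (exp_boundedX 1 (exp_bounded_sin a)).
have SE (a : R) : - gauss_transform (fun w => w * sin (a * w)) z =
   cintegral Ioo (fun w => gauss_kernel z w * (- (w * sin (a * w)))%:C).
  rewrite -mulN1r -cintegralZ //.
  by apply: eq_cintegral => w _; rewrite rmorphN /=; ring.
have dRe (a : R) : is_derive a 1 (fun b => Re (G b)) (- (a / 2) * (r * Re (G a) - s * Im (G a))).
  have := dG a _ (normr_Re_gauss_kernel z) (@measurable_Re_gauss_kernel R z).
  rewrite -(funext GRe) => h; apply: (is_derive_eq h).
  transitivity (Re (- (a / 2)%:C * (v * G a))); last by rewrite !ReIm /=; ring.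
  by rewrite -ode SE; apply: eq_Rintegral => w _; rewrite ReMr.
have dIm (a : R) : is_derive a 1 (fun b => Im (G b)) (- (a / 2) * (r * Im (G a) + s * Re (G a))).
  have := dG a _ (normr_Im_gauss_kernel z) (@measurable_Im_gauss_kernel R z).
  rewrite -(funext GIm) => h; apply: (is_derive_eq h).
  transitivity (Im (- (a / 2)%:C * (v * G a))); last by rewrite !ReIm /=; ring.
  by rewrite -ode SE; apply: eq_Rintegral => w _; rewrite ImMr.
pose E (a : R) := cexp ((a ^+ 2 / 4)%:C * v).
have vRe (x : R) : Re (x%:C * v) = x * r by rewrite mulrC ReMr mulrC.
have vIm (x : R) : Im (x%:C * v) = x * s by rewrite mulrC ImMr mulrC.
have ERe (a : R) : Re (E a) = expR (a ^+ 2 / 4 * r) * cos (a ^+ 2 / 4 * s).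
  by rewrite -vRe -vIm.
have EIm (a : R) : Im (E a) = expR (a ^+ 2 / 4 * r) * sin (a ^+ 2 / 4 * s).
  by rewrite -vRe -vIm.
have cst1 : G b * E b = G 0 * E 0.
  apply: eqC.
    rewrite !ReM !ERe !EIm.
    apply: (@is_derive_0_is_cst R (fun a => Re (G a) * (expR (a ^+ 2 / 4 * r) * cos (a ^+ 2 / 4 * s))
       - Im (G a) * (expR (a ^+ 2 / 4 * r) * sin (a ^+ 2 / 4 * s)))) => a.
    by have h1 := dRe a; have h2 := dIm a; der; field.
  rewrite !ImM !ERe !EIm.
  apply: (@is_derive_0_is_cst R (fun a => Re (G a) * (expR (a ^+ 2 / 4 * r) * sin (a ^+ 2 / 4 * s))
     + Im (G a) * (expR (a ^+ 2 / 4 * r) * cos (a ^+ 2 / 4 * s)))) => a.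
  by have h1 := dRe a; have h2 := dIm a; der; field.
have -> : gauss_transform (fun=> 1) z = G 0.
  by apply: eq_cintegral => w _; rewrite mul0r cos0.
have E0 : E 0 = 1 by rewrite /E expr0n /= mul0r mul0r cexp0.
rewrite E0 mulr1 in cst1.
rewrite -cst1 -mulrA /E -cexpD mulNr addrC addNr cexp0 mulr1 //.
Qed.

End GaussFourier.

(** * Multiple-angle formulas *)

Section Trigonometry.
Variable R : realType.
Implicit Types (x y : R).

Lemma sinDnpi x n : sin (x + n%:R * pi) = (-1) ^+ n * sin x.
Proof.
elim: n => [|n IH]; first by rewrite mul0r addr0 expr0 mul1r.
by rewrite -natr1 mulrDl mul1r addrA sinDpi IH exprS; ring.
Qed.

(** Tripling the angle in cos pi = - 1 gives (c + 1) (2 c - 1)^2 = 0, and c > 0 excludes c = - 1. *)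
Lemma cos_pi3 : cos (pi / 3) = 1 / 2 :> R.
Proof.
have p0 := pi_gt0 R.
have c0 : 0 < cos (pi / 3 : R) by apply: cos_gt0_pihalf; apply/andP; split; lra.
have h : cos (pi / 3 + (pi / 3 + pi / 3)) = -1 :> R.
  by rewrite (_ : pi / 3 + (pi / 3 + pi / 3) = pi) ?cospi //; field.
move: h; rewrite !cosD !sinD; have := cos2Dsin2 (pi / 3 : R).
set c := cos _ in c0 *; set s := sin _ => e h.
have h2 : (c + 1) * (2 * c - 1) ^+ 2 = 0.
  have -> : (c + 1) * (2 * c - 1) ^+ 2 =
    (c * (c * c - s * s) - s * (s * c + c * s)) + 1 + 3 * c * (c ^+ 2 + s ^+ 2 - 1) by ring.
  by rewrite h e; ring.
move/eqP: h2; rewrite mulf_eq0 sqrf_eq0 => /orP[] /eqP; lra.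
Qed.

Lemma sin_pi3 : sin (pi / 3) = Num.sqrt 3 / 2 :> R.
Proof.
have p0 := pi_gt0 R.
have s0 : 0 < sin (pi / 3 : R) by apply: sin_gt0_pi; apply/andP; split; lra.
have := cos2Dsin2 (pi / 3 : R); rewrite cos_pi3 => e.
have e2 : sin (pi / 3 : R) ^+ 2 = (Num.sqrt 3 / 2) ^+ 2.
  by rewrite expr_div_n sqr_sqrtr //; lra.
by apply/eqP; rewrite -(eqrXn2 (n:=2)) ?e2 // ?(ltW s0) // divr_ge0 ?sqrtr_ge0.
Qed.

(** These formulas are polynomials in cosh x alone or sin x alone, so that the closed form of the
    dual kernel becomes a polynomial identity in cosh (2 w) and sin th. *)
Lemma cosh3 x : cosh (3 * x) = 4 * cosh x ^+ 3 - 3 * cosh x.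
Proof.
rewrite (_ : 3 * x = x + (x + x)); last by ring.
rewrite !(coshD, sinhD); have := sqr_cosh x.
set c := cosh x; set s := sinh x => e.
have -> : c * (c * c + s * s) + s * (s * c + c * s) = c * c ^+ 2 + 3 * c * s ^+ 2 by ring.
have -> : s ^+ 2 = c ^+ 2 - 1 by rewrite e; ring.
by ring.
Qed.

Lemma sin3 x : sin (3 * x) = 3 * sin x - 4 * sin x ^+ 3.
Proof.
rewrite (_ : 3 * x = x + (x + x)); last by ring.
rewrite !(cosD, sinD); have := cos2Dsin2 x.
set c := cos x; set s := sin x => e.
have -> : s * (c * c - s * s) + c * (s * c + c * s) = 3 * s * c ^+ 2 - s ^+ 3 by ring.
have -> : c ^+ 2 = 1 - s ^+ 2 by rewrite -e; ring.
by ring.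
Qed.

Lemma cosh6 x : cosh (6 * x) = 2 * (4 * cosh x ^+ 3 - 3 * cosh x) ^+ 2 - 1.
Proof.
rewrite (_ : 6 * x = 3 * x + 3 * x); last by ring.
by rewrite coshD -cosh3 -!expr2; have := sqr_cosh (3 * x); lra.
Qed.

Lemma cos6 x : cos (6 * x) = 1 - 2 * (3 * sin x - 4 * sin x ^+ 3) ^+ 2.
Proof.
rewrite (_ : 6 * x = 3 * x + 3 * x); last by ring.
by rewrite cosD -sin3 -!expr2; have := cos2Dsin2 (3 * x); lra.
Qed.

Lemma cosh5 x : cosh (5 * x) = 16 * cosh x ^+ 5 - 20 * cosh x ^+ 3 + 5 * cosh x.
Proof.
rewrite (_ : 5 * x = 3 * x + (x + x)); last by ring.
have e3 : sinh (3 * x) = sinh x * (4 * cosh x ^+ 2 - 1).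
  rewrite (_ : 3 * x = x + (x + x)); last by ring.
  rewrite !(coshD, sinhD); have := sqr_cosh x.
  set c := cosh x; set s := sinh x => e.
  have -> : s * (c * c + s * s) + c * (s * c + c * s) = s * (3 * c ^+ 2 + s ^+ 2) by ring.
  have -> : s ^+ 2 = c ^+ 2 - 1 by rewrite e; ring.
  by ring.
rewrite coshD cosh3 e3 coshD sinhD; have := sqr_cosh x.
set c := cosh x; set s := sinh x => e.
have -> : (4 * c ^+ 3 - 3 * c) * (c * c + s * s) + s * (4 * c ^+ 2 - 1) * (s * c + c * s)
  = (4 * c ^+ 3 - 3 * c) * (c ^+ 2 + s ^+ 2) + s ^+ 2 * (4 * c ^+ 2 - 1) * (2 * c) by ring.
have -> : s ^+ 2 = c ^+ 2 - 1 by rewrite e; ring.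
by ring.
Qed.

Lemma sin5 x : sin (5 * x) = 16 * sin x ^+ 5 - 20 * sin x ^+ 3 + 5 * sin x.
Proof.
rewrite (_ : 5 * x = 3 * x + (x + x)); last by ring.
have e3 : cos (3 * x) = cos x * (1 - 4 * sin x ^+ 2).
  rewrite (_ : 3 * x = x + (x + x)); last by ring.
  rewrite !(cosD, sinD); have := cos2Dsin2 x.
  set c := cos x; set s := sin x => e.
  have -> : c * (c * c - s * s) - s * (s * c + c * s) = c * (c ^+ 2 - 3 * s ^+ 2) by ring.
  have -> : c ^+ 2 = 1 - s ^+ 2 by rewrite -e; ring.
  by ring.
rewrite sinD sin3 e3 cosD sinD; have := cos2Dsin2 x.
set c := cos x; set s := sin x => e.
have -> : (3 * s - 4 * s ^+ 3) * (c * c - s * s) + c * (1 - 4 * s ^+ 2) * (s * c + c * s)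
  = (3 * s - 4 * s ^+ 3) * (c ^+ 2 - s ^+ 2) + c ^+ 2 * (1 - 4 * s ^+ 2) * (2 * s) by ring.
have -> : c ^+ 2 = 1 - s ^+ 2 by rewrite -e; ring.
by ring.
Qed.

Lemma cosh_add_sub x y : cosh (x + y) + cosh (x - y) = 2 * (cosh x * cosh y).
Proof. by rewrite !coshD coshN sinhN; ring. Qed.

Lemma sinh_add_sub x y : sinh (x + y) + sinh (x - y) = 2 * (sinh x * cosh y).
Proof. by rewrite !sinhD coshN sinhN; ring. Qed.

End Trigonometry.

(** * Closed form of the dual kernel *)

Section DualKernel.
Variable R : realType.
Implicit Types (th w : R).

(* m = cos (2 pi / 3 - th) and n = cos (pi / 3 - th). *)
Lemma dual_kernel_closed_form th w (m n : R) :
  m = - cos th / 2 + Num.sqrt 3 * sin th / 2 ->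
  n = cos th / 2 + Num.sqrt 3 * sin th / 2 ->
  m != 0 -> n != 0 -> cos th != 0 ->
  let Q := cosh (12 * w) + cos (6 * th) in
  Q != 0 /\
  cosh (2 * w) * m / (sinh (2 * w) ^+ 2 + m ^+ 2) +
  cosh (2 * w) * n / (sinh (2 * w) ^+ 2 + n ^+ 2) =
  2 * Num.sqrt 3 * (sin th * cosh (10 * w) - sin (5 * th) * cosh (2 * w)) / Q.
Proof.
move=> em en m0 n0 c0 Q.
have ec := sqr_cosh (2 * w).
have r2 : Num.sqrt 3 ^+ 2 = 3 :> R by rewrite sqr_sqrtr.
have cs := cos2Dsin2 th.
(* The symmetric functions m + n and m n depend on sin th only. *)
have mn1 : m + n = Num.sqrt 3 * sin th by rewrite em en; field.
have mn2 : m * n = sin th ^+ 2 - 1 / 4.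
  rewrite em en.
  have -> : (- cos th / 2 + Num.sqrt 3 * sin th / 2) * (cos th / 2 + Num.sqrt 3 * sin th / 2)
    = (Num.sqrt 3 ^+ 2 * sin th ^+ 2 - cos th ^+ 2) / 4 by field.
  rewrite r2; lra.
have s2 : 0 <= sinh (2 * w) ^+ 2 by exact: sqr_ge0.
have pos (x : R) : x != 0 -> 0 < sinh (2 * w) ^+ 2 + x ^+ 2.
  by move=> x0; rewrite ltr_wpDl // exprn_even_gt0.
have Dm := pos _ m0; have Dn := pos _ n0; have Dc := pos _ c0.
have e12 : cosh (12 * w) = cosh (6 * (2 * w)) by congr cosh; ring.
have e10 : cosh (10 * w) = cosh (5 * (2 * w)) by congr cosh; ring.
move: ec s2 Dm Dn Dc; rewrite /Q e12 e10 cosh6 cosh5 cos6 sin5.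
set c := cosh (2 * w); set s := sinh (2 * w); set S := sin th; set r := Num.sqrt 3.
move=> ec s2 Dm Dn Dc.
have es : s ^+ 2 = c ^+ 2 - 1 by rewrite ec; ring.
(* A factorisation over the angles 2 pi / 3 - th, pi / 3 - th and th. The two summands supply the
   first two factors; the third, s^2 + cos^2 th = c^2 - S^2, also divides the numerator sin th cosh
   10 w - sin 5 th cosh 2 w and cancels. *)
have eQ : 2 * (4 * c ^+ 3 - 3 * c) ^+ 2 - 1 + (1 - 2 * (3 * S - 4 * S ^+ 3) ^+ 2)
  = 32 * ((s ^+ 2 + m ^+ 2) * (s ^+ 2 + n ^+ 2) * (s ^+ 2 + cos th ^+ 2)).
  have -> : (s ^+ 2 + m ^+ 2) * (s ^+ 2 + n ^+ 2)
    = (s ^+ 2) ^+ 2 + s ^+ 2 * ((m + n) ^+ 2 - 2 * (m * n)) + (m * n) ^+ 2 by ring.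
  rewrite mn1 mn2 (exprMn _ (Num.sqrt 3)) r2 es (_ : cos th ^+ 2 = 1 - S ^+ 2); last by move: cs; rewrite -/S; lra.
  by rewrite -/S; field.
rewrite eQ.
have P0 : (s ^+ 2 + m ^+ 2) * (s ^+ 2 + n ^+ 2) * (s ^+ 2 + cos th ^+ 2) != 0.
  by rewrite !mulf_neq0 // gt_eqF.
split; first by rewrite mulf_neq0.
have -> : c * m / (s ^+ 2 + m ^+ 2) + c * n / (s ^+ 2 + n ^+ 2)
  = c * ((m + n) * (s ^+ 2 + m * n)) / ((s ^+ 2 + m ^+ 2) * (s ^+ 2 + n ^+ 2)).
  by field; rewrite !gt_eqF.
rewrite mn1 mn2 -/S -/r.
set D := (s ^+ 2 + m ^+ 2) * (s ^+ 2 + n ^+ 2).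
have D0 : D != 0 by rewrite mulf_neq0 // gt_eqF.
have cE : s ^+ 2 + cos th ^+ 2 = c ^+ 2 - S ^+ 2 by move: cs; rewrite es -/S; lra.
rewrite cE es; rewrite cE in Dc.
by field; rewrite D0 gt_eqF.
Qed.

End DualKernel.

(** * A telescoping sum for two three-term recurrences *)

Section Telescoping.
Variable R : realType.
Variables (th a w : R).

(** For th = pi j / p this is, up to a factor independent of k, the entry (j, k) of the mixing
    matrix. *)
Definition alt_sin (k : nat) : R := (-1) ^+ k * sin (6 * k%:R * th).
(** Used with a = 6 p w and a = 2 p w, which gives the two families of hyperbolic cosines that occur
    in the kernels. *)
Definition cosh_shift (k : nat) : R := cosh (a - 12 * k%:R * w).

Lemma alt_sin_rec k :
  alt_sin k.+2 + alt_sin k = - 2 * cos (6 * th) * alt_sin k.+1.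
Proof.
rewrite /alt_sin.
have -> : 6 * k.+2%:R * th = 6 * k.+1%:R * th + 6 * th by rewrite -!natr1; ring.
have -> : 6 * k%:R * th = 6 * k.+1%:R * th - 6 * th by rewrite -!natr1; ring.
by rewrite !exprS !sinD cosN sinN; ring.
Qed.

Lemma cosh_shift_rec k :
  cosh_shift k.+2 + cosh_shift k = 2 * cosh (12 * w) * cosh_shift k.+1.
Proof.
rewrite /cosh_shift; set x := a - 12 * k.+1%:R * w.
have -> : a - 12 * k.+2%:R * w = x - 12 * w by rewrite /x -!natr1; ring.
have -> : a - 12 * k%:R * w = x + 12 * w by rewrite /x -!natr1; ring.
by rewrite addrC cosh_add_sub; ring.
Qed.

(** A discrete Wronskian argument: both sequences solve f (k + 1) + f (k - 1) = c f (k), with c = -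
    2 cos (6 th) and c = 2 cosh (12 w) respectively, and the difference of these constants is the
    factor in front of the sum. *)
Lemma telescoping_sum m :
  2 * (cosh (12 * w) + cos (6 * th)) * (\sum_(k < m) alt_sin k.+1 * cosh_shift k.+1)
  = alt_sin 1 * cosh_shift 0 - alt_sin m.+1 * cosh_shift m + alt_sin m * cosh_shift m.+1.
Proof.
elim: m => [|m IH].
  have s0 : alt_sin 0 = 0 by rewrite /alt_sin mulr0 mul0r sin0 mulr0.
  by rewrite big_ord0 s0; ring.
rewrite big_ord_recr /= mulrDr IH.
have h1 := alt_sin_rec m; have h2 := cosh_shift_rec m.
have -> : alt_sin m.+2 = - 2 * cos (6 * th) * alt_sin m.+1 - alt_sin m by rewrite -h1; ring.
have -> : cosh_shift m.+2 = 2 * cosh (12 * w) * cosh_shift m.+1 - cosh_shift m.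
  by rewrite -h2; ring.
by ring.
Qed.

End Telescoping.

(** Neither 2 nor 3 divides p. This excludes 6 j = p and leaves two cases for the boundary terms of
    the sum over k. *)
Lemma prime_ge5_mod6 p : prime p -> (5 <= p)%N -> (p %% 6 = 1 \/ p %% 6 = 5)%N.
Proof.
move=> pp p5.
have h2 : ~~ (2 %| p)%N by rewrite dvdn_prime2 //; apply/eqP; lia.
have h3 : ~~ (3 %| p)%N by rewrite dvdn_prime2 //; apply/eqP; lia.
lia.
Qed.

(** * The kernels g_j and their sum against a row of the mixing matrix *)

Section MordellKernel.
Variable R : realType.
Variable p : nat.

(* The sum of the four quotients of hyperbolic sines in the j-th coordinate,
   after cancelling 2 sinh (6 p u). *)
Definition kernel_freq (j : nat) : R :=
  if (6 * j < p)%N then 4 * p%:R + 12 * j%:R else 8 * p%:R - 12 * j%:R.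

(** The boolean exponent encodes sign (6 j - p), which is nonzero for p prime to 6. *)
Definition mordell_kernel (j : nat) (u : R) : R :=
  ((-1) ^+ (6 * j < p)%N * cosh (kernel_freq j * u) + cosh ((4 * p%:R - 12 * j%:R) * u))
  / cosh (6 * p%:R * u).

(** Product-to-sum formulas move the dependence on j into cosh ((6 p - 12 j) u) and, when 6 j < p,
    cosh ((2 p - 12 j) u). Both have the shape of [cosh_shift], so sums over j telescope. *)
Lemma mordell_kernelE j u :
  mordell_kernel j u =
   2 * cosh (2 * p%:R * u) / cosh (6 * p%:R * u) * cosh (6 * p%:R * u - 12 * j%:R * u)
   - (if (6 * j < p)%N then 2 * cosh (2 * p%:R * u - 12 * j%:R * u) else 0).
Proof.
have c0 : cosh (6 * p%:R * u) != 0 by rewrite gt_eqF // cosh_gt0.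
rewrite /mordell_kernel /kernel_freq.
set x := p%:R * u; set y := j%:R * u.
have k1 : 2 * p%:R * u = 2 * x by rewrite /x; ring.
have k2 : 6 * p%:R * u = 6 * x by rewrite /x; ring.
have k3 : 12 * j%:R * u = 12 * y by rewrite /y; ring.
have k4 : (4 * p%:R - 12 * j%:R) * u = 6 * x - 12 * y - 2 * x by rewrite /x /y; ring.
rewrite k1 k4 k3; rewrite k2 in c0 *.
have h := cosh_add_sub (6 * x - 12 * y) (2 * x).
have h2 : cosh ((6 * x - 12 * y) + 2 * x) + cosh ((4 * p%:R + 12 * j%:R) * u)
   = 2 * (cosh (6 * x) * cosh (2 * x - 12 * y)).
  by rewrite -cosh_add_sub; congr (cosh _ + cosh _); rewrite /x /y; ring.
have k5 : (8 * p%:R - 12 * j%:R) * u = (6 * x - 12 * y) + 2 * x by rewrite /x /y; ring.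
case: ifP => _; last first.
  by rewrite expr0 mul1r k5 h subr0; field.
have e1 : cosh ((4 * p%:R + 12 * j%:R) * u) =
  2 * (cosh (6 * x) * cosh (2 * x - 12 * y)) - cosh ((6 * x - 12 * y) + 2 * x).
  by rewrite -h2; ring.
have e2 : cosh (6 * x - 12 * y - 2 * x) =
  2 * (cosh (6 * x - 12 * y) * cosh (2 * x)) - cosh ((6 * x - 12 * y) + 2 * x).
  by rewrite -h; ring.
by rewrite expr1 e1 e2; field.
Qed.

Hypotheses (p_prime : prime p) (p_ge5 : (5 <= p)%N).

Let pR0 : p%:R != 0 :> R. Proof. by rewrite pnatr_eq0; lia. Qed.

(** Two sums telescope: over all k with a = 6 p w, and over 6 k < p with a = 2 p w. Only the lower
    boundary term of the first survives, and it cancels against the lower one of the second; the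
    result consists of the upper boundary terms of the second. *)
Lemma sum_mordell_kernel (j : nat) (w : R) :
  let th := pi * j%:R / p%:R in
  (cosh (12 * w) + cos (6 * th)) *
     (\sum_(k < ell p) alt_sin th k.+1 * mordell_kernel k.+1 w) =
  (-1) ^+ ((p + 3) %/ 6 + j) * (sin th * cosh (10 * w) - sin (5 * th) * cosh (2 * w)).
Proof.
move=> th; set l := ell p; set Q := _ + _.
have pl : p = (2 * l).+1.
  have : ~~ (2 %| p)%N by rewrite dvdn_prime2 //; apply/eqP; lia.
  by rewrite /l /ell; lia.
set m := (p %/ 6)%N.
(* With indices shifted by one, 6 k.+1 < p means k < p %/ 6, since 6 does not divide p. *)
have mE : \sum_(k < l) alt_sin th k.+1 *
     (if (6 * k.+1 < p)%N then 2 * cosh (2 * p%:R * w - 12 * k.+1%:R * w) else 0)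
  = 2 * \sum_(k < m) alt_sin th k.+1 * cosh_shift (2 * p%:R * w) w k.+1 :> R.
  have ml : (m <= l)%N by rewrite /m; lia.
  rewrite mulr_sumr (big_ord_widen l (fun k => 2 * (alt_sin th k.+1 * cosh_shift (2 * p%:R * w) w k.+1))) //.
  rewrite [RHS]big_mkcond /=; apply: eq_bigr => k _.
  have -> : (6 * k.+1 < p)%N = (k < m)%N.
    by have := prime_ge5_mod6 p_prime p_ge5; rewrite /m; lia.
  by case: ifP => _; rewrite /cosh_shift ?mulr0 //; ring.
have sE : \sum_(k < l) alt_sin th k.+1 * mordell_kernel k.+1 w =
   2 * cosh (2 * p%:R * w) / cosh (6 * p%:R * w) *
      (\sum_(k < l) alt_sin th k.+1 * cosh_shift (6 * p%:R * w) w k.+1)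
   - 2 * \sum_(k < m) alt_sin th k.+1 * cosh_shift (2 * p%:R * w) w k.+1.
  rewrite -mE mulr_sumr -sumrB; apply: eq_bigr => k _.
  by rewrite mordell_kernelE /cosh_shift; ring.
have T1 := telescoping_sum th (6 * p%:R * w) w l.
have T2 := telescoping_sum th (2 * p%:R * w) w m.
rewrite -/Q in T1 T2.
have pthl : p%:R * th = j%:R * pi by rewrite /th; field.
(* k -> p - k is a symmetry of the full sum, so its upper boundary terms cancel. *)
have sl : alt_sin th l.+1 = alt_sin th l.
  rewrite /alt_sin.
  have -> : 6 * l.+1%:R * th = - (6 * l%:R * th) + (6 * j)%:R * pi.
    have -> : (6 * j)%:R * pi = 6 * (p%:R * th) :> R by rewrite pthl natrM; ring.
    by rewrite pl -!natr1 natrM; ring.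
  have s6 : (-1) ^+ (6 * j) = 1 :> R by rewrite -signr_odd oddM /= expr0.
  by rewrite sinDnpi s6 sinN exprS; ring.
have cl : cosh_shift (6 * p%:R * w) w l.+1 = cosh_shift (6 * p%:R * w) w l.
  by rewrite /cosh_shift -coshN; congr cosh; rewrite pl -!natr1 natrM; ring.
have T1' : 2 * Q * (\sum_(k < l) alt_sin th k.+1 * cosh_shift (6 * p%:R * w) w k.+1)
   = alt_sin th 1 * cosh (6 * p%:R * w).
  by rewrite T1 sl cl /cosh_shift mulr0 mul0r subr0; ring.
have c0 : cosh (6 * p%:R * w) != 0 by rewrite gt_eqF // cosh_gt0.
have step : Q * (\sum_(k < l) alt_sin th k.+1 * mordell_kernel k.+1 w)
   = alt_sin th m.+1 * cosh_shift (2 * p%:R * w) w m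
     - alt_sin th m * cosh_shift (2 * p%:R * w) w m.+1.
  rewrite sE.
  set S1 := (X in _ * X - _) in T1' *; set S2 := (X in _ - 2 * X).
  have -> : Q * (2 * cosh (2 * p%:R * w) / cosh (6 * p%:R * w) * S1 - 2 * S2)
    = cosh (2 * p%:R * w) / cosh (6 * p%:R * w) * (2 * Q * S1) - 2 * Q * S2 by field.
  have cs0 : cosh_shift (2 * p%:R * w) w 0 = cosh (2 * p%:R * w) by rewrite /cosh_shift mulr0 mul0r subr0.
  rewrite T1' T2 cs0.
  by field.
rewrite step.
have pE : p = (6 * m + p %% 6)%N by rewrite /m; lia.
set r := (p %% 6)%N in pE.
have pER : p%:R = 6 * m%:R + r%:R :> R by rewrite {1}pE natrD natrM.
(* As 6 m = p - r and p th = j pi, the boundary values at m and m.+1 depend, up to sign, only on r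
   and 6 - r. *)
have a0 : alt_sin th m = - ((-1) ^+ (m + j) * sin (r%:R * th)).
  rewrite /alt_sin.
  have -> : 6 * m%:R * th = - (r%:R * th) + j%:R * pi by rewrite -pthl pER; ring.
  by rewrite sinDnpi sinN exprD; ring.
have a1 : alt_sin th m.+1 = - ((-1) ^+ (m + j) * sin ((6 - r%:R) * th)).
  rewrite /alt_sin.
  have -> : 6 * m.+1%:R * th = (6 - r%:R) * th + j%:R * pi by rewrite -pthl pER -natr1; ring.
  by rewrite sinDnpi exprD exprS; ring.
have d0 : cosh_shift (2 * p%:R * w) w m = cosh (2 * r%:R * w).
  by rewrite /cosh_shift pER; congr cosh; ring.
have d1 : cosh_shift (2 * p%:R * w) w m.+1 = cosh ((12 - 2 * r%:R) * w).
  by rewrite /cosh_shift -coshN pER; congr cosh; rewrite -natr1; ring.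
rewrite a0 a1 d0 d1.
(* Passing from r = 1 to r = 5 exchanges the two boundary terms and hence the sign, while (p + 3) %/
   6 jumps from m to m.+1: this is the origin of the floor in the exponent of the mixing matrix. *)
case: (prime_ge5_mod6 p_prime p_ge5); rewrite -/r => rE.
  have -> : ((p + 3) %/ 6 = m)%N by lia.
  rewrite rE.
  have -> : (12 - 2 * 1) * w = 10 * w by ring.
  have -> : (6 - 1) * th = 5 * th by ring.
  have -> : 2 * 1 * w = 2 * w by ring.
  by rewrite mul1r; ring.
have -> : ((p + 3) %/ 6 = m.+1)%N by lia.
rewrite rE addSn exprS.
have -> : (12 - 2 * 5) * w = 2 * w by ring.
have -> : (6 - 5) * th = th by ring.
have -> : 2 * 5 * w = 10 * w by ring.
by ring.
Qed.

End MordellKernel.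

(** * Exchange of two integrations against a cosine *)

Section FubiniCos.
Variable R : realType.
Local Notation mu := (@lebesgue_measure R).
Local Notation Ioo := (`[(0:R), +oo[%classic).

Lemma integrable_bounded_mul (f b : R -> R) :
  mu.-integrable setT (EFin \o f) -> measurable_fun setT b -> (forall w, `|b w| <= 1) ->
  mu.-integrable setT (EFin \o (fun w => b w * f w)).
Proof.
move=> fi mb b1.
have mf : measurable_fun setT f by apply/measurable_EFinP; exact: measurable_int fi.
apply: (le_integrable _ _ _ fi) => //.
  by apply/measurable_EFinP; exact: measurable_funM.
by move=> w _ /=; rewrite lee_fin normrM ler_piMl.
Qed.

(** The integrand is dominated by |k u| |W w|, whose iterated integral is a product of two finite
    numbers. Both functions are extended by 0, so that Fubini's theorem is applied on the whole
    plane. *)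
Lemma Fubini_cos (k W : R -> R) (c : R) :
  mu.-integrable Ioo (EFin \o k) -> mu.-integrable Ioo (EFin \o W) ->
  \int[mu]_(u in Ioo) (k u * \int[mu]_(w in Ioo) (cos (c * u * w) * W w)) =
  \int[mu]_(w in Ioo) (W w * \int[mu]_(u in Ioo) (k u * cos (c * u * w))).
Proof.
move=> ik iW.
pose kI := k \_ Ioo; pose WI := W \_ Ioo.
have iF (f : R -> R) : mu.-integrable Ioo (EFin \o f) -> mu.-integrable setT (EFin \o (f \_ Ioo)).
  by move=> h; rewrite -restrict_EFin; refine ((integrable_mkcond _ _).1 h).
have ikI : mu.-integrable setT (EFin \o kI) by exact: iF.
have iWI : mu.-integrable setT (EFin \o WI) by exact: iF.
have mkI : measurable_fun setT kI by apply/measurable_EFinP; exact: measurable_int ikI.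
have mWI : measurable_fun setT WI by apply/measurable_EFinP; exact: measurable_int iWI.
have mcos (a : R) : measurable_fun setT (fun w : R => cos (a * w)).
  apply: continuous_measurable_fun => w.
  have d : is_derive w 1 (fun w => cos (a * w)) (- sin (a * w) * a) by der; ring.
  exact: (is_derive_continuous d).
have inW u : \int[mu]_(w in Ioo) (cos (c * u * w) * W w) = \int[mu]_w (cos (c * u * w) * WI w).
  rewrite Rintegral_mkcond; apply: eq_Rintegral => w _.
  by rewrite /WI /patch; case: ifP => _ //; rewrite mulr0.
have ink w : \int[mu]_(u in Ioo) (k u * cos (c * u * w)) = \int[mu]_u (kI u * cos (c * u * w)).
  rewrite Rintegral_mkcond; apply: eq_Rintegral => u _.
  by rewrite /kI /patch; case: ifP => _ //; rewrite mul0r.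
have -> : \int[mu]_(u in Ioo) (k u * \int[mu]_(w in Ioo) (cos (c * u * w) * W w))
  = \int[mu]_u (kI u * \int[mu]_w (cos (c * u * w) * WI w)).
  rewrite Rintegral_mkcond; apply: eq_Rintegral => u _.
  by rewrite /kI /patch; case: ifP => _; rewrite ?mul0r // inW.
have -> : \int[mu]_(w in Ioo) (W w * \int[mu]_(u in Ioo) (k u * cos (c * u * w)))
  = \int[mu]_w (WI w * \int[mu]_u (kI u * cos (c * u * w))).
  rewrite Rintegral_mkcond; apply: eq_Rintegral => w _.
  by rewrite /WI /patch; case: ifP => _; rewrite ?mul0r // ink.
pose F (x : R * R) : \bar R := (kI x.1 * cos (c * x.1 * x.2) * WI x.2)%:E.
have e1 u : ((kI u * \int[mu]_w (cos (c * u * w) * WI w))%:E = \int[mu]_w F (u, w))%E.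
  have ii := integrable_bounded_mul iWI (mcos (c * u)) (fun w => cos_max _).
  rewrite -(@RintegralZl _ _ _ mu) // /Rintegral fineK.
    by apply: eq_integral => w _; rewrite /F /= mulrA.
  by apply: integrable_fin_num => //; refine (integrableZl _ (kI u) ii).
have e2 w : ((WI w * \int[mu]_u (kI u * cos (c * u * w)))%:E = \int[mu]_u F (u, w))%E.
  have ii := integrable_bounded_mul ikI (mcos (c * w)) (fun w => cos_max _).
  have -> : \int[mu]_u (kI u * cos (c * u * w)) = \int[mu]_u (cos (c * w * u) * kI u).
    by apply: eq_Rintegral => u _; rewrite mulrC mulrAC.
  rewrite -(@RintegralZl _ _ _ mu) // /Rintegral fineK.
    by apply: eq_integral => u _; rewrite /F /= (mulrAC c w u); congr EFin; ring.
  by apply: integrable_fin_num => //; refine (integrableZl _ (WI w) ii).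
rewrite /Rintegral; congr fine.
under eq_integral do rewrite -/(Rintegral mu setT _) e1.
under [RHS]eq_integral do rewrite -/(Rintegral mu setT _) e2.
apply: (@Fubini _ _ _ _ R mu mu F).
have mfst : measurable_fun setT (fun x : R * R => kI x.1) by exact: measurableT_comp.
have msnd : measurable_fun setT (fun x : R * R => WI x.2) by exact: measurableT_comp.
have mco : measurable_fun setT (fun x : R * R => cos (c * x.1 * x.2)).
  apply: (@measurableT_comp _ _ _ _ _ _ (@cos R)).
    by apply: continuous_measurable_fun; exact: continuous_cos.
  by apply: measurable_funM => //; exact: measurable_funM.
have mprod : measurable_fun setT (fun x : R * R => (kI x.1 * WI x.2)%:E).
  by apply/measurable_EFinP; exact: measurable_funM.
have ip : (mu \x mu)%E.-integrable setT (fun x : R * R => (kI x.1 * WI x.2)%:E).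
  apply/integrable12ltyP => //=.
  have absI (f : R -> R) : mu.-integrable setT (EFin \o f) ->
      exists r : R, (\int[mu]_w `|f w|%:E = r%:E)%E.
    move=> /integrableP[mf foo].
    exists (fine (\int[mu]_w `|f w|%:E)%E); rewrite fineK // ge0_fin_numE //.
    exact: integral_ge0.
  have [rk ek] := absI _ ikI; have [rW eW] := absI _ iWI.
  have inner u : (\int[mu]_w `|kI u * WI w|%:E = `|kI u|%:E * rW%:E)%E.
    rewrite -eW -(@ge0_integralZl_EFin _ _ _ mu) //.
      by apply: eq_integral => w _; rewrite normrM EFinM.
    by apply/measurable_EFinP; exact: measurableT_comp.
  under eq_integral do rewrite inner muleC.
  rewrite ge0_integralZl_EFin //.
  - by rewrite ek -EFinM ltry.
  - by apply/measurable_EFinP; exact: measurableT_comp.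
  - by rewrite -lee_fin -eW; exact: integral_ge0.
apply: (le_integrable _ _ _ ip) => //.
  by apply/measurable_EFinP; apply: measurable_funM => //; exact: measurable_funM.
move=> x _; rewrite /F /= lee_fin mulrAC normrM; apply: ler_piMr => //; exact: cos_max.
Qed.

End FubiniCos.

(** * The dual kernel W_j and the duality of Gaussian transforms *)

Section DualKernel.
Variable R : realType.
Local Notation mu := (@lebesgue_measure R).
Local Notation Ioo := (`[(0:R), +oo[%classic).
Local Notation C := R[i].
Local Notation Re := (@complex.Re R).
Local Notation Im := (@complex.Im R).
Variable p : nat.

(** The angle s for which x s / 2 is frequency times u when x = 24 p u / pi; it is below pi / 2 in
    absolute value exactly when the frequency is below 6 p. *)
Definition kernel_angle1 (j : nat) : R := kernel_freq R p j * pi / (12 * p%:R).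
Definition kernel_angle2 (j : nat) : R := (4 * p%:R - 12 * j%:R) * pi / (12 * p%:R).

Definition dual_kernel (j : nat) (w : R) : R :=
  (-1) ^+ (6 * j < p)%N * sech_re (kernel_angle1 j) w + sech_re (kernel_angle2 j) w.

Lemma normr_cosh_le (a u : R) : 0 <= u -> `|cosh (a * u)| <= expR (`|a| * u).
Proof.
move=> u0; rewrite ger0_norm; last by rewrite ltW // cosh_gt0.
have h1 : expR (a * u) <= expR (`|a| * u) by rewrite ler_expR ler_wpM2r // ler_norm.
have h2 : expR (- (a * u)) <= expR (`|a| * u).
  by rewrite ler_expR -mulNr ler_wpM2r // -normrN ler_norm.
by rewrite /cosh; lra.
Qed.

Lemma exp_bounded_mordell_kernel j : exp_bounded (mordell_kernel p j : R -> R).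
Proof.
split.
  apply: is_derive_measurable_Ioo => w _; rewrite /mordell_kernel; eexists.
  by der_step; rewrite gt_eqF // cosh_gt0.
pose a := kernel_freq R p j; pose b : R := 4 * p%:R - 12 * j%:R.
exists 2, (`|a| + `|b|); split => // u u0.
rewrite /mordell_kernel -/a -/b normrM.
have i1 : `|(cosh (6 * p%:R * u))^-1| <= 1.
  rewrite normfV invf_le1 ?normr_gt0 ?gt_eqF ?cosh_gt0 //.
  by rewrite ger0_norm ?cosh_ge1 // ltW // cosh_gt0.
rewrite -[leRHS]mulr1; apply: ler_pM => //.
apply: (le_trans (ler_normD _ _)); rewrite mulr_natl mulr2n; apply: lerD.
  rewrite normrM normrX normrN1 expr1n mul1r; apply: (le_trans (normr_cosh_le _ u0)).
  by rewrite ler_expR ler_wpM2r // lerDl.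
apply: (le_trans (normr_cosh_le _ u0)).
by rewrite ler_expR ler_wpM2r // lerDr.
Qed.

Hypotheses (p_prime : prime p) (p_ge5 : (5 <= p)%N).
Variable j : nat.
Hypotheses (j_gt0 : (0 < j)%N) (j_le : (j <= ell p)%N).

Let pR0 : 0 < p%:R :> R. Proof. by rewrite ltr0n; lia. Qed.
Let pN0 : p%:R != 0 :> R. Proof. by rewrite gt_eqF. Qed.
Let jR0 : 0 < j%:R :> R. Proof. by rewrite ltr0n. Qed.
Let j2p : 2 * j%:R < p%:R :> R.
Proof. by rewrite -natrM ltr_nat; move: j_le; rewrite /ell; lia. Qed.
Let th : R := pi * j%:R / p%:R.
Let th0 : 0 < th. Proof. by rewrite divr_gt0 // mulr_gt0 // pi_gt0. Qed.
Let th2 : th < pi / 2.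
Proof. by rewrite /th ltr_pdivrMr // mulrAC ltr_pdivlMr // -mulrA ltr_pM2l ?pi_gt0 // mulrC. Qed.

Let ang2E : kernel_angle2 j = pi / 3 - th.
Proof. by rewrite /kernel_angle2 /th; field. Qed.

Let ang1E : kernel_angle1 j = if (6 * j < p)%N then pi / 3 + th else 2 * (pi / 3) - th.
Proof. by rewrite /kernel_angle1 /kernel_freq /th; case: ifP => _; field. Qed.

Lemma kernel_angle2_lt : `|kernel_angle2 j| < pi / 2.
Proof.
by rewrite ang2E ltr_norml; have := pi_gt0 R; move: th0 th2 => ? ? ?; apply/andP; split; lra.
Qed.

(** The two formulas, pi / 3 + th and 2 pi / 3 - th, meet the forbidden value pi / 2 at th = pi / 6,
    that is at 6 j = p. On its own side of that point each stays below pi / 2. *)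
Lemma kernel_angle1_lt : `|kernel_angle1 j| < pi / 2.
Proof.
rewrite ang1E ltr_norml; have pi0 := pi_gt0 R; have t0 := th0; have t2 := th2.
case: ifP => h.
  have : th < pi / 6.
    rewrite /th ltr_pdivrMr // mulrAC ltr_pdivlMr // -mulrA ltr_pM2l //.
    by rewrite -natrM ltr_nat; lia.
  by move=> ?; apply/andP; split; lra.
have : pi / 6 < th.
  rewrite /th ltr_pdivlMr // mulrAC ltr_pdivrMr // -mulrA ltr_pM2l //.
  rewrite -natrM ltr_nat.
  by have := prime_ge5_mod6 p_prime p_ge5; move: h; lia.
by move=> ?; apply/andP; split; lra.
Qed.

Lemma dual_kernel_bound : exists2 K : R, 0 <= K &
  forall w, 0 <= w -> `|dual_kernel j w| <= K * expR (- w).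
Proof.
have c1 : 0 < cos (kernel_angle1 j).
  by apply: cos_gt0_pihalf; rewrite -ltr_norml kernel_angle1_lt.
have c2 : 0 < cos (kernel_angle2 j).
  by apply: cos_gt0_pihalf; rewrite -ltr_norml kernel_angle2_lt.
exists (cos (kernel_angle1 j) ^- 2 * 2 + cos (kernel_angle2 j) ^- 2 * 2).
  by rewrite addr_ge0 // mulr_ge0 // invr_ge0 exprn_ge0 // ltW.
move=> w w0; rewrite mulrDl; apply: (le_trans (ler_normD _ _)); apply: lerD.
  by rewrite normrM normrX normrN1 expr1n mul1r; exact: sech_re_le.
exact: sech_re_le.
Qed.

Lemma measurable_dual_kernel : measurable_fun Ioo (dual_kernel j).
Proof.
have c1 : 0 < cos (kernel_angle1 j).
  by apply: cos_gt0_pihalf; rewrite -ltr_norml kernel_angle1_lt.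
have c2 : 0 < cos (kernel_angle2 j).
  by apply: cos_gt0_pihalf; rewrite -ltr_norml kernel_angle2_lt.
apply: is_derive_measurable_Ioo => w _; eexists; rewrite /dual_kernel.
have d1 := derw_sech_re w c1; have d2 := derw_sech_re w c2.
eapply der_add; last exact: d2.
eapply der_mul; [exact: der_cst|exact: d1].
Qed.

Lemma exp_bounded_dual_kernel : exp_bounded (dual_kernel j).
Proof.
have [K K0 hK] := dual_kernel_bound.
apply: (@exp_bounded_bounded _ _ K); first exact: measurable_dual_kernel.
move=> w w0; apply: (le_trans (hK w w0)); apply: ler_piMr => //.
by rewrite -expR0 ler_expR; lra.
Qed.

Lemma integrable_sech_re_cos (x t : R) : `|t| < pi / 2 ->
  mu.-integrable Ioo (EFin \o (fun w => cos (x * w) * sech_re t w)).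
Proof.
move=> ht; have c0 : 0 < cos t by apply: cos_gt0_pihalf; rewrite -ltr_norml.
apply: (@integrable_le_expN _ _ (cos t ^- 2 * 2)).
  apply: is_derive_measurable_Ioo => w _; eexists.
  have d := derw_sech_re w c0.
  eapply der_mul; [|exact: d]; der_step.
by move=> w w0; apply: normrM_le1l; [exact: cos_max|exact: sech_re_le].
Qed.

(** [sech_fourier] read backwards at x = 24 p u / pi, chosen so that its denominator becomes cosh (6
    p u); the factor 4 / pi undoes its pi / 4. *)
Lemma mordell_kernel_fourier (u : R) :
  mordell_kernel p j u =
  4 / pi * \int[mu]_(w in Ioo) (cos (24 * p%:R / pi * u * w) * dual_kernel j w).
Proof.
have pi0 : pi != 0 :> R by rewrite gt_eqF // pi_gt0.
set x := 24 * p%:R / pi * u.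
have i1 := integrable_sech_re_cos x kernel_angle1_lt.
have i2 := integrable_sech_re_cos x kernel_angle2_lt.
have -> : \int[mu]_(w in Ioo) (cos (x * w) * dual_kernel j w) =
  \int[mu]_(w in Ioo) ((-1) ^+ (6 * j < p)%N * (cos (x * w) * sech_re (kernel_angle1 j) w)
     + 1 * (cos (x * w) * sech_re (kernel_angle2 j) w)).
  by apply: eq_Rintegral => w _; rewrite /dual_kernel; ring.
rewrite Rintegral_lin2 // !sech_fourier ?kernel_angle1_lt ?kernel_angle2_lt //.
have -> : x / 2 * (pi / 2) = 6 * p%:R * u.
  by rewrite /x; move: pi0; move: (pi : R) => q q0; field.
have -> : x / 2 * kernel_angle1 j = kernel_freq R p j * u.
  by rewrite /x /kernel_angle1; move: pi0; move: (pi : R) => q q0; field; rewrite pN0 q0.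
have -> : x / 2 * kernel_angle2 j = (4 * p%:R - 12 * j%:R) * u.
  by rewrite /x /kernel_angle2; move: pi0; move: (pi : R) => q q0; field; rewrite pN0 q0.
rewrite /mordell_kernel.
move: (lt0r_neq0 (cosh_gt0 (6 * p%:R * u))); move: (cosh (6 * p%:R * u)) => d d0.
move: pi0; move: (pi : R) => q q0; field.
by rewrite q0 d0.
Qed.

(** Both sides are the same fraction over cosh (12 w) + cos (6 th): the left one by the closed form,
    the right one by the telescoped sum. *)
Lemma dual_kernel_mordell (w : R) :
  dual_kernel j w = 2 * Num.sqrt 3 * (-1) ^+ ((p + 3) %/ 6 + j)
    * \sum_(k < ell p) alt_sin th k.+1 * mordell_kernel p k.+1 w.
Proof.
have c1 : 0 < cos (kernel_angle1 j).
  by apply: cos_gt0_pihalf; rewrite -ltr_norml kernel_angle1_lt.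
have c2 : 0 < cos (kernel_angle2 j).
  by apply: cos_gt0_pihalf; rewrite -ltr_norml kernel_angle2_lt.
have c3 : 0 < cos th by apply: cos_gt0_pihalf; apply/andP; split; move: th0 th2 (pi_gt0 R); lra.
set b := (6 * j < p)%N.
(* The sign removes the case distinction: - cos (pi / 3 + th) = cos (2 pi / 3 - th). The
   denominators contain only squares and are unaffected by it. *)
have em : (-1) ^+ b * cos (kernel_angle1 j) = - cos th / 2 + Num.sqrt 3 * sin th / 2.
  rewrite ang1E -/b; case: b => /=.
    by rewrite expr1 cosD cos_pi3 sin_pi3; field.
  rewrite expr0 mul1r (_ : 2 * (pi / 3) - th = (- (pi / 3) - th) + pi); last by field.
  by rewrite cosDpi cosD cosN sinN cosN sinN cos_pi3 sin_pi3; field.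
have en : cos (kernel_angle2 j) = cos th / 2 + Num.sqrt 3 * sin th / 2.
  by rewrite ang2E cosD cosN sinN cos_pi3 sin_pi3; field.
have m0 : (-1) ^+ b * cos (kernel_angle1 j) != 0 by rewrite mulf_neq0 ?signr_eq0 // gt_eqF.
have n0 : cos (kernel_angle2 j) != 0 by rewrite gt_eqF.
have [] := @dual_kernel_closed_form R th w _ _ em en m0 n0 (lt0r_neq0 c3).
set Q := _ + _ => Q0 h.
have sq : ((-1) ^+ b) ^+ 2 = 1 :> R by rewrite sqrr_sign.
have -> : dual_kernel j w = cosh (2 * w) * ((-1) ^+ b * cos (kernel_angle1 j)) /
    (sinh (2 * w) ^+ 2 + ((-1) ^+ b * cos (kernel_angle1 j)) ^+ 2) +
    cosh (2 * w) * cos (kernel_angle2 j) / (sinh (2 * w) ^+ 2 + cos (kernel_angle2 j) ^+ 2).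
  by rewrite (exprMn _ ((-1) ^+ b)) sq mul1r /dual_kernel /sech_re /sech_den; ring.
have hs := @sum_mordell_kernel R p p_prime p_ge5 j w; rewrite /= -/th -/Q in hs.
rewrite h; set S := \sum_(k < ell p) _ in hs *.
have sg2 : (-1) ^+ ((p + 3) %/ 6 + j) * (-1) ^+ ((p + 3) %/ 6 + j) = 1 :> R.
  by rewrite -expr2 sqrr_sign.
have -> : sin th * cosh (10 * w) - sin (5 * th) * cosh (2 * w) = (-1) ^+ ((p + 3) %/ 6 + j) * (Q * S).
  by rewrite hs mulrA sg2 mul1r.
by field.
Qed.

(** Insert the cosine transform of the kernel, exchange the integrals and evaluate the inner
    Gaussian at frequency 24 p w / pi. A quarter of its square is (12 p / pi)^2 w^2, hence the new
    parameter; the constant is (4 / pi) (sqrt pi / 2). *)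
Theorem mordell_duality (z : C) : 0 < Re z ->
  gauss_transform (mordell_kernel p j) z =
  (2 / Num.sqrt pi)%:C / sqrtc z * gauss_transform (dual_kernel j) (((12 * p%:R / pi) ^+ 2)%:C / z).
Proof.
move=> z0; set z' := _ / z.
have z'0 : 0 < Re z'.
  rewrite /z' mulrC ReMr mulr_gt0 ?exprn_gt0 ?divr_gt0 ?mulr_gt0 ?pi_gt0 //.
  move: z0; case: (z) => a b /= a0; rewrite mulr_gt0 // invr_gt0.
  by rewrite ltr_pwDl ?exprn_gt0 ?sqr_ge0.
have [K K0 hK] := dual_kernel_bound.
have iW : mu.-integrable Ioo (EFin \o dual_kernel j).
  by apply: (integrable_le_expN _ hK); exact: measurable_dual_kernel.
set c : R := 24 * p%:R / pi.
(* The exchange is done for a real weight k, to be taken as either component of the Gaussian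
   kernel. *)
have one (k : R -> R) : measurable_fun Ioo k -> (forall w, `|k w| <= expR (- Re z * w ^+ 2)) ->
  \int[mu]_(u in Ioo) (k u * mordell_kernel p j u) =
  4 / pi * \int[mu]_(w in Ioo) (dual_kernel j w * \int[mu]_(u in Ioo) (k u * cos (c * w * u))).
  move=> mk hk.
  have ik : mu.-integrable Ioo (EFin \o k).
    have [K0' _ hK0] := gauss_kernel_bound z0 (@exp_bounded1 R).
    apply: (integrable_le_expN mk) => w w0.
    by have := hK0 w (k w) w0 (hk w); rewrite mulr1; exact.
  have -> : \int[mu]_(w in Ioo) (dual_kernel j w * \int[mu]_(u in Ioo) (k u * cos (c * w * u)))
    = \int[mu]_(w in Ioo) (dual_kernel j w * \int[mu]_(u in Ioo) (k u * cos (c * u * w))).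
    by apply: eq_Rintegral => w _; congr (_ * _); apply: eq_Rintegral => u _; rewrite (mulrAC c w).
  rewrite -Fubini_cos //.
  have pi0 : pi != 0 :> R by rewrite gt_eqF // pi_gt0.
  have e u : k u * \int[mu]_(w in Ioo) (cos (c * u * w) * dual_kernel j w)
     = pi / 4 * (k u * mordell_kernel p j u).
    rewrite mordell_kernel_fourier -/c; move: (Rintegral _ _ _) => I.
    by move: pi0; move: (pi : R) => q q0; field.
  under [in RHS]eq_Rintegral do rewrite e.
  rewrite RintegralZl //.
    move: (Rintegral _ _ _) => I; by move: pi0; move: (pi : R) => q q0; field.
  have [K1 K10 hK1] := gauss_kernel_bound z0 (exp_bounded_mordell_kernel j).
  apply: (@integrable_le_expN _ _ K1).
    by apply: measurable_funM => //; case: (exp_bounded_mordell_kernel j).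
  by move=> w w0; apply: hK1.
have LE : gauss_transform (mordell_kernel p j) z =
  (4 / pi)%:C * cintegral Ioo (fun w => gauss_transform (fun u => cos (c * w * u)) z * (dual_kernel j w)%:C).
  apply: eqC.
    rewrite mulrC ReMr [RHS]mulrC !Re_cintegral.
    transitivity (\int[mu]_(u in Ioo) (Re (gauss_kernel z u) * mordell_kernel p j u)).
      by apply: eq_Rintegral => u _; rewrite ReMr.
    rewrite one; [|exact: measurable_Re_gauss_kernel|exact: normr_Re_gauss_kernel].
    congr (_ * _); apply: eq_Rintegral => w _; rewrite ReMr mulrC; congr (_ * _).
    by rewrite Re_cintegral; apply: eq_Rintegral => u _; rewrite ReMr.
  rewrite mulrC ImMr [RHS]mulrC !Im_cintegral.
  transitivity (\int[mu]_(u in Ioo) (Im (gauss_kernel z u) * mordell_kernel p j u)).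
    by apply: eq_Rintegral => u _; rewrite ImMr.
  rewrite one; [|exact: measurable_Im_gauss_kernel|exact: normr_Im_gauss_kernel].
  congr (_ * _); apply: eq_Rintegral => w _; rewrite ImMr mulrC; congr (_ * _).
  by rewrite Im_cintegral; apply: eq_Rintegral => u _; rewrite ImMr.
have pi0 : 0 < pi :> R by exact: pi_gt0.
have s0 : sqrtc z != 0 by apply: Re_gt0_neq0; exact: Re_sqrtc_gt0.
have z0' : z != 0 by exact: Re_gt0_neq0.
have GE w : gauss_transform (fun u => cos (c * w * u)) z * (dual_kernel j w)%:C =
   ((Num.sqrt pi / 2)%:C / sqrtc z) * (gauss_kernel z' w * (dual_kernel j w)%:C).
  rewrite gauss_fourier // mulrA; congr (_ * _ * _); rewrite /gauss_kernel; congr cexp.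
  have e : (c * w) ^+ 2 / 4 = (12 * p%:R / pi) ^+ 2 * w ^+ 2.
    by rewrite /c; move: (lt0r_neq0 pi0); move: (pi : R) => q q0; field.
  by rewrite /z' !mulNr e rmorphM /= [in RHS]mulrAC.
rewrite LE (eq_cintegral (fun w _ => GE w)) cintegralZ; last first.
  exact: gauss_kernel_integrable z'0 exp_bounded_dual_kernel.
rewrite mulrA; congr (_ * _); rewrite mulrA -rmorphM; congr (_%:C / _).
have sp : Num.sqrt pi ^+ 2 = pi :> R by rewrite sqr_sqrtr // ltW.
have sp0 : Num.sqrt pi != 0 :> R by rewrite gt_eqF // sqrtr_gt0.
by rewrite -{1}sp; move: sp0; move: (Num.sqrt _ : R) => q q0; field.
Qed.

End DualKernel.

(** * The coordinates as Gaussian transforms, and their holomorphy *)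

Section Mordell.
Variable R : realType.
Local Notation mu := (@lebesgue_measure R).
Local Notation Ioo := (`[(0:R), +oo[%classic).
Local Notation C := R[i].
Local Notation Re := (@complex.Re R).
Local Notation Im := (@complex.Im R).
Implicit Types (z t : C) (P a : int).

(** The quotients of hyperbolic sines are 0 at u = 0 by convention, where [mordell_kernel] need not
    vanish; discarding that point allows the two to be compared. *)
Lemma eq_cintegral_gt0 (f g : R -> C) : cintegrable f -> cintegrable g ->
  (forall w, 0 < w -> f w = g w) -> cintegral Ioo f = cintegral Ioo g.
Proof.
move=> [f1 f2] [g1 g2] fg.
have aux (h k : R -> R) : mu.-integrable Ioo (EFin \o h) -> mu.-integrable Ioo (EFin \o k) ->
    (forall w, 0 < w -> h w = k w) ->
    \int[mu]_(w in Ioo) h w = \int[mu]_(w in Ioo) k w.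
  move=> ih ik hk.
  have sub (l : R -> R) : mu.-integrable Ioo (EFin \o l) ->
      mu.-integrable `]0%R, +oo[%classic (EFin \o l).
    move=> il; apply: (integrableS _ _ _ il) => //.
    by move=> x /=; rewrite !in_itv /= !andbT; exact: ltW.
  rewrite -!Rintegral_itv_obnd_cbnd; [|exact: sub..].
  by apply: eq_Rintegral => w; rewrite inE /= in_itv /= andbT; exact: hk.
by rewrite /cintegral; congr (_ +i* _); apply: aux => // w w0; rewrite fg.
Qed.

Definition sinh_ratio P a (u : R) : R := sinh ((P - a)%:~R * u) / sinh (P%:~R * u).

Lemma JS_gauss_transform P a t :
  JS P a t = t^-1 * gauss_transform (sinh_ratio P a) ((P%:~R : R)%:C / t).
Proof.
congr (_ * _); apply: eq_cintegral => u _; congr (cexp _ * _).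
by rewrite rmorphM /= !mulNr mulrAC.
Qed.

Lemma sinh_le (x y : R) : x <= y -> sinh x <= sinh y.
Proof.
move=> xy; have h1 : expR x <= expR y by rewrite ler_expR.
have h2 : expR (- y) <= expR (- x) by rewrite ler_expR lerN2.
by rewrite /sinh; lra.
Qed.

(** As |P - a| <= P and sinh is increasing, the quotient is at most 1 in absolute value. *)
Lemma exp_bounded_sinh_ratio P a : 0 <= P -> 0 <= a <= 2 * P -> exp_bounded (sinh_ratio P a).
Proof.
move=> P0 /andP[a0 aP].
have PR : 0 <= P%:~R :> R by rewrite ler0z.
apply: (@exp_bounded_bounded _ _ 1).
  have m1 : measurable_fun Ioo (fun u : R => sinh ((P - a)%:~R * u)).
    by apply: is_derive_measurable_Ioo => w _; eexists; der_step.
  (* The denominator vanishes at 0, so measurability does not come from continuity; the inverse is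
     expressed by the real power of exponent - 1, with which it agrees on nonnegative numbers. *)
  have m2 : measurable_fun Ioo (fun u : R => sinh (P%:~R * u) `^ (-1)).
    apply: (@measurableT_comp _ _ _ _ _ _ (fun x : R => x `^ (-1))); first exact: measurable_powR.
    by apply: is_derive_measurable_Ioo => w _; eexists; der_step.
  apply: eq_measurable_fun (measurable_funM m1 m2) => u.
  rewrite inE /= in_itv /= andbT => u0; rewrite powR_inv1 //.
  by apply: sinh_ge0; rewrite mulr_ge0.
move=> u u0.
have S0 : 0 <= sinh (P%:~R * u) by apply: sinh_ge0; rewrite mulr_ge0.
have Sle : `|sinh ((P - a)%:~R * u)| <= sinh (P%:~R * u).
  rewrite ler_norml -sinhN; apply/andP; split; apply: sinh_le.
    by rewrite -mulNr ler_wpM2r // -rmorphN ler_int; lia.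
  by rewrite ler_wpM2r // ler_int; lia.
rewrite /sinh_ratio normrM normfV (ger0_norm S0).
have [->|Sn] := eqVneq (sinh (P%:~R * u)) 0; first by rewrite invr0 mulr0.
by rewrite ler_pdivrMr ?mul1r // lt_neqAle eq_sym Sn.
Qed.

Lemma divc_Re_gt0 (x : R) t : 0 < x -> 0 < Re t -> 0 < Re (x%:C / t).
Proof.
move=> x0 t0; rewrite mulrC ReMr mulr_gt0 //.
move: t0; case: t => a b /= a0; rewrite mulr_gt0 // invr_gt0.
by rewrite ltr_pwDl ?exprn_gt0 ?sqr_ge0.
Qed.

Lemma derivable_compc (f g : C -> C) z :
  derivable (f : C^o -> C^o) z 1 -> derivable (g : C^o -> C^o) (f z) 1 ->
  derivable ((g \o f) : C^o -> C^o) z 1.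
Proof.
move=> /derivable1_diffP df /derivable1_diffP dg.
by apply/derivable1_diffP; exact: (differentiable_comp df dg).
Qed.

Lemma derivable_mulc (f g : C -> C) z :
  derivable (f : C^o -> C^o) z 1 -> derivable (g : C^o -> C^o) z 1 ->
  derivable ((fun t => f t * g t) : C^o -> C^o) z 1.
Proof. by move=> df dg; exact (derivableM df dg). Qed.

Lemma derivable_addc (f g : C -> C) z :
  derivable (f : C^o -> C^o) z 1 -> derivable (g : C^o -> C^o) z 1 ->
  derivable ((fun t => f t + g t) : C^o -> C^o) z 1.
Proof. by move=> df dg; exact (derivableD df dg). Qed.

Lemma derivable_cstc (c : C) z : derivable ((fun=> c) : C^o -> C^o) z 1.
Proof. exact (@derivable_cst C C^o C^o c z 1). Qed.

Lemma derivable_JS P a z : 0 < P -> 0 <= a <= 2 * P -> 0 < Re z ->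
  derivable (JS P a : C^o -> C^o) z 1.
Proof.
move=> P0 aP z0; have zn0 : z != 0 by exact: Re_gt0_neq0.
have -> : (JS P a : C -> C) =
  (fun t => t^-1 * (gauss_transform (sinh_ratio P a) \o (fun t => (P%:~R : R)%:C / t)) t).
  by apply/funext => t; rewrite JS_gauss_transform.
have dV : derivable ((fun t => t^-1) : C^o -> C^o) z 1.
  by apply: derivableV => //; exact: derivable_id.
apply: (derivable_mulc dV); apply: derivable_compc.
  exact (derivable_mulc (@derivable_cstc (P%:~R : R)%:C z) dV).
have w0 : 0 < Re ((P%:~R : R)%:C / z) by apply: divc_Re_gt0; rewrite ?ltr0z.
have eb : exp_bounded (sinh_ratio P a) by apply: exp_bounded_sinh_ratio => //; exact: ltW.
by case: (gauss_transform_is_derive w0 eb).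
Qed.

Variable p : nat.
Hypotheses (p_prime : prime p) (p_ge5 : (5 <= p)%N).

Lemma holomorphic_calL_coord (j : nat) : (0 < j <= ell p)%N ->
  holomorphic_on [set t : C | 0 < Re t] (fun t => calL_coord (Posz p) (Posz j) t).
Proof.
move=> /andP[j0 jl] z /= z0.
have j2 : (2 * j < p)%N by move: jl; rewrite /ell; lia.
have pi0 := pi_gt0 R.
have s0 : 0 < Re ((48 * Posz p)%:~R * z / pi%:C).
  have -> : ((48 * Posz p)%:~R * z / pi%:C : C) = z * (48 * p%:R / pi)%:C.
    have -> : (48 * Posz p)%:~R = (48 * p%:R : R)%:C :> C.
      by rewrite intrM rmorphM /= -!pmulrn !rmorph_nat.
    by rewrite [in RHS]rmorphM fmorphV /=; ring.
  by rewrite ReMr mulr_gt0 // divr_gt0 // mulr_gt0 // ltr0n; lia.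
rewrite /calL_coord.
have dJ a : 0 <= a <= 2 * (12 * Posz p) -> derivable (JS (12 * Posz p) a : C^o -> C^o) z 1.
  by move=> ha; apply: derivable_JS => //; lia.
have did : derivable ((fun t => t) : C^o -> C^o) z 1 by exact: derivable_id.
have dlin := derivable_mulc (derivable_mulc (@derivable_cstc (48 * Posz p)%:~R z) did)
  (@derivable_cstc (pi%:C)^-1 z).
have dsq : derivable (@sqrtc R : C^o -> C^o) ((48 * Posz p)%:~R * z / pi%:C) 1.
  by case: (sqrtc_is_derive s0).
have d1 : derivable (JS (12 * Posz p) `|12 * Posz j - 2 * Posz p| : C^o -> C^o) z 1.
  by apply: dJ; lia.
have d2 : derivable (JS (12 * Posz p) (14 * Posz p - 12 * Posz j) : C^o -> C^o) z 1.
  by apply: dJ; lia.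
have d3 : derivable (JS (12 * Posz p) (12 * Posz j + 2 * Posz p) : C^o -> C^o) z 1.
  by apply: dJ; lia.
have d4 : derivable (JS (12 * Posz p) (10 * Posz p - 12 * Posz j) : C^o -> C^o) z 1.
  by apply: dJ; lia.
have dc := @derivable_cstc (Num.sg (6 * Posz j - Posz p))%:~R z.
exact (derivable_mulc (derivable_compc dlin dsq)
  (derivable_addc (derivable_addc (derivable_addc (derivable_mulc dc d1) d2) d3) d4)).
Qed.

(** With x = p u, the common denominator is sinh (12 x) = 2 sinh (6 x) cosh (6 x). The first two and
    the last two numerators each add up to 2 sinh (6 x) times a hyperbolic cosine, and sinh (6 x)
    can be cancelled because u > 0. *)
Lemma sinh_ratio_sum (j : nat) (u : R) : (0 < j <= ell p)%N -> 0 < u ->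
  (Num.sg (6 * Posz j - Posz p))%:~R * sinh_ratio (12 * Posz p) `|12 * Posz j - 2 * Posz p| u
  + sinh_ratio (12 * Posz p) (14 * Posz p - 12 * Posz j) u
  + sinh_ratio (12 * Posz p) (12 * Posz j + 2 * Posz p) u
  + sinh_ratio (12 * Posz p) (10 * Posz p - 12 * Posz j) u = mordell_kernel p j u.
Proof.
move=> /andP[j0 jl] u0.
rewrite /sinh_ratio /mordell_kernel /kernel_freq.
pose x := p%:R * u; pose y := j%:R * u.
have x0 : 0 < x by rewrite /x mulr_gt0 // ltr0n; lia.
have S6 : sinh (6 * x) != 0.
  have h := sinh2_ge (ltW (mulr_gt0 (ltr0n R 3) x0)).
  rewrite (_ : 6 * x = 2 * (3 * x)); last by ring.
  by rewrite gt_eqF //; lra.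
have C6 : cosh (6 * x) != 0 by rewrite gt_eqF // cosh_gt0.
have den : sinh ((12 * Posz p)%:~R * u) = 2 * sinh (6 * x) * cosh (6 * x).
  rewrite (_ : (12 * Posz p)%:~R * u = 6 * x + 6 * x); last first.
    by rewrite intrM -!pmulrn /x; ring.
  by rewrite sinhD; ring.
have k1 : 6 * p%:R * u = 6 * x by rewrite /x; ring.
have k2 : (4 * p%:R - 12 * j%:R) * u = 4 * x - 12 * y by rewrite /x /y; ring.
rewrite den k1 k2.
have n2 : (12 * Posz p - (14 * Posz p - 12 * Posz j))%:~R * u = 12 * y - 2 * x.
  by rewrite (_ : _ - _ = 12 * Posz j - 2 * Posz p); [rewrite intrB !intrM -!pmulrn /x /y; ring|lia].
have n3 : (12 * Posz p - (12 * Posz j + 2 * Posz p))%:~R * u = 10 * x - 12 * y.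
  by rewrite (_ : _ - _ = 10 * Posz p - 12 * Posz j); [rewrite intrB !intrM -!pmulrn /x /y; ring|lia].
have n4 : (12 * Posz p - (10 * Posz p - 12 * Posz j))%:~R * u = 2 * x + 12 * y.
  by rewrite (_ : _ - _ = 2 * Posz p + 12 * Posz j); [rewrite intrD !intrM -!pmulrn /x /y; ring|lia].
rewrite n2 n3 n4.
have h34 : sinh (10 * x - 12 * y) + sinh (2 * x + 12 * y) = 2 * (sinh (6 * x) * cosh (4 * x - 12 * y)).
  by rewrite -sinh_add_sub; congr (sinh _ + sinh _); ring.
case: ifP => h.
  have -> : Num.sg (6 * Posz j - Posz p) = -1 by apply: ltr0_sg; lia.
  have n1 : (12 * Posz p - `|12 * Posz j - 2 * Posz p|)%:~R * u = 10 * x + 12 * y.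
    rewrite ler0_norm; last by lia.
    by rewrite (_ : _ - _ = 10 * Posz p + 12 * Posz j); [rewrite intrD !intrM -!pmulrn /x /y; ring|lia].
  rewrite n1 expr1.
  have h12 : sinh (10 * x + 12 * y) + sinh (2 * x - 12 * y) = 2 * (sinh (6 * x) * cosh (4 * x + 12 * y)).
    by rewrite -sinh_add_sub; congr (sinh _ + sinh _); ring.
  have -> : sinh (12 * y - 2 * x) = - sinh (2 * x - 12 * y) by rewrite -sinhN; congr sinh; ring.
  have -> : (4 * p%:R + 12 * j%:R) * u = 4 * x + 12 * y by rewrite /x /y; ring.
  have -> : sinh (10 * x + 12 * y) = 2 * (sinh (6 * x) * cosh (4 * x + 12 * y)) - sinh (2 * x - 12 * y).
    by rewrite -h12; ring.
  have -> : sinh (10 * x - 12 * y) = 2 * (sinh (6 * x) * cosh (4 * x - 12 * y)) - sinh (2 * x + 12 * y).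
    by rewrite -h34; ring.
  move: S6 C6; move: (sinh (6 * x)) (cosh (6 * x)) => s c s0 c0.
  by rewrite rmorphN rmorph1; field; rewrite s0 c0.
have -> : Num.sg (6 * Posz j - Posz p) = 1.
  by apply: gtr0_sg; have := prime_ge5_mod6 p_prime p_ge5; move: h; lia.
have n1 : (12 * Posz p - `|12 * Posz j - 2 * Posz p|)%:~R * u = 14 * x - 12 * y.
  rewrite ger0_norm; last by move: h; lia.
  by rewrite (_ : _ - _ = 14 * Posz p - 12 * Posz j); [rewrite intrB !intrM -!pmulrn /x /y; ring|lia].
rewrite n1 expr0.
have h12 : sinh (14 * x - 12 * y) + sinh (12 * y - 2 * x) = 2 * (sinh (6 * x) * cosh (8 * x - 12 * y)).
  by rewrite -sinh_add_sub; congr (sinh _ + sinh _); ring.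
have -> : (8 * p%:R - 12 * j%:R) * u = 8 * x - 12 * y by rewrite /x /y; ring.
have -> : sinh (14 * x - 12 * y) = 2 * (sinh (6 * x) * cosh (8 * x - 12 * y)) - sinh (12 * y - 2 * x).
  by rewrite -h12; ring.
have -> : sinh (10 * x - 12 * y) = 2 * (sinh (6 * x) * cosh (4 * x - 12 * y)) - sinh (2 * x + 12 * y).
  by rewrite -h34; ring.
move: S6 C6; move: (sinh (6 * x)) (cosh (6 * x)) => s c s0 c0.
by rewrite rmorph1; field; rewrite s0 c0.
Qed.

(** By linearity the four integrals merge into one, whose integrand agrees with that of g_j for w >
    0. *)
Lemma calL_coordE (j : nat) t : (0 < j <= ell p)%N -> 0 < Re t ->
  calL_coord (Posz p) (Posz j) t =
  sqrtc ((48 * p%:R / pi)%:C * t) *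
    (t^-1 * gauss_transform (mordell_kernel p j) ((12 * p%:R)%:C / t)).
Proof.
move=> jp t0; have [j0 jl] := andP jp.
have j2 : (2 * j < p)%N by move: jl; rewrite /ell; lia.
rewrite /calL_coord.
have -> : (48 * Posz p)%:~R * t / pi%:C = (48 * p%:R / pi)%:C * t.
  have -> : (48 * Posz p)%:~R = (48 * p%:R : R)%:C :> C.
    by rewrite intrM rmorphM /= -!pmulrn !rmorph_nat.
  by rewrite [in RHS]rmorphM fmorphV /=; ring.
congr (_ * _); rewrite !JS_gauss_transform.
have PE : (12 * Posz p)%:~R = 12 * p%:R :> R by rewrite intrM -!pmulrn.
rewrite PE; set z := _ / t.
have z0 : 0 < Re z by apply: divc_Re_gt0 => //; rewrite mulr_gt0 // ltr0n; lia.
set sg := Num.sg _.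
have i a : 0 <= a <= 2 * (12 * Posz p) ->
  cintegrable (fun w => gauss_kernel z w * (sinh_ratio (12 * Posz p) a w)%:C).
  by move=> ha; apply: gauss_kernel_integrable => //; apply: exp_bounded_sinh_ratio.
have i1 : cintegrable (fun w => gauss_kernel z w *
    (sinh_ratio (12 * Posz p) `|12 * Posz j - 2 * Posz p| w)%:C) by apply: i; lia.
have i2 : cintegrable (fun w => gauss_kernel z w *
    (sinh_ratio (12 * Posz p) (14 * Posz p - 12 * Posz j) w)%:C) by apply: i; lia.
have i3 : cintegrable (fun w => gauss_kernel z w *
    (sinh_ratio (12 * Posz p) (12 * Posz j + 2 * Posz p) w)%:C) by apply: i; lia.
have i4 : cintegrable (fun w => gauss_kernel z w *
    (sinh_ratio (12 * Posz p) (10 * Posz p - 12 * Posz j) w)%:C) by apply: i; lia.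
have i1' := cintegrableZ (sg%:~R : C) i1.
rewrite mulrCA -!mulrDr; congr (_ * _).
rewrite /gauss_transform -cintegralZ // -cintegralD //.
rewrite -cintegralD //; last exact: cintegrableD.
rewrite -cintegralD //; last by do 2 (apply: cintegrableD => //).
apply: eq_cintegral_gt0.
- by do 3 (apply: cintegrableD => //).
- exact: gauss_kernel_integrable z0 (exp_bounded_mordell_kernel _ _ _).
have castE (a1 a2 a3 a4 : R) :
    (sg%:~R * a1 + a2 + a3 + a4)%:C = sg%:~R * a1%:C + a2%:C + a3%:C + a4%:C :> C.
  by rewrite !rmorphD rmorphM rmorph_int.
by move=> w w0; rewrite -(sinh_ratio_sum jp w0) -/sg castE; ring.
Qed.

End Mordell.

(** * The transformation law: constants and branches of the roots *)

Theorem proposition2p6 (R : realType) (p : nat) (p_prime : prime p)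
    (p_ge5 : (5 <= p)%N) :
  (forall i : 'I_(ell p),
     holomorphic_on [set t : R[i] | 0 < complex.Re t]
       (fun t => calL p t i ord0))
  /\
  (forall t : R[i], 0 < complex.Re t ->
     calL p t =
       sqrtc (pi%:C / t) *:
         (map_mx (real_complex R) (mixing_mx R p) *m calL p (pi%:C ^+ 2 / t))).
Proof.
split.
  move=> i; have hi : (0 < i.+1 <= ell p)%N by rewrite /= ltn_ord.
  have -> : (fun t => calL p t i ord0) = (fun t : R[i] => calL_coord (Posz p) (Posz i.+1) t).
    by apply/funext => t; rewrite mxE.
  exact: holomorphic_calL_coord.
move=> t t0; apply/colP => i; rewrite !mxE.
have hi : (0 < i.+1 <= ell p)%N by rewrite /= ltn_ord.
have pi0 := pi_gt0 R.
have pR0 : 0 < p%:R :> R by rewrite ltr0n; lia.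
have tn0 : t != 0 by exact: Re_gt0_neq0.
have pC0 : pi%:C != 0 :> R[i] by rewrite -[0]/(0%:C) (inj_eq (@complexI _)) gt_eqF.
have t'0 : 0 < complex.Re (pi%:C ^+ 2 / t).
  by rewrite -rmorphXn; apply: divc_Re_gt0 => //; rewrite exprn_gt0.
set t' := pi%:C ^+ 2 / t in t'0 *.
have [i0 ile] := andP hi.
have z0 : 0 < complex.Re ((12 * p%:R)%:C / t : R[i]).
  by apply: divc_Re_gt0 => //; rewrite mulr_gt0.
rewrite (calL_coordE p_prime p_ge5) // (mordell_duality p_prime p_ge5 i0 ile z0).
pose z' : R[i] := (12 * p%:R)%:C / t'.
have z'0 : 0 < complex.Re z' by apply: divc_Re_gt0 => //; rewrite mulr_gt0.
(* The dual Gaussian parameter is 12 p / t', that is the parameter of the coordinates at t' = pi^2 /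
   t. *)
have -> : ((12 * p%:R / pi) ^+ 2)%:C / ((12 * p%:R)%:C / t) = z'.
  rewrite /z' /t' expr_div_n rmorphM fmorphV !rmorphXn /=.
  have n0 : (12 * p%:R)%:C != 0 :> R[i].
    by rewrite -[0]/(0%:C) (inj_eq (@complexI _)) gt_eqF // mulr_gt0.
  move: pC0 n0; move: (pi%:C) ((12 * p%:R)%:C) => q n q0 n0.
  by field; rewrite q0 n0 tn0.
pose D := gauss_transform (dual_kernel p i.+1) z'.
(* By linearity the matrix acts on kernels. The dual kernel carries the factor 2 sqrt 3 where the
   matrix has 2 / sqrt p, which leaves 1 / (sqrt p sqrt 3). *)
have sum : \sum_(k < ell p) map_mx (real_complex R) (mixing_mx R p) i k * calL p t' k ord0
  = sqrtc ((48 * p%:R / pi)%:C * t') * t'^-1 * ((Num.sqrt p%:R * Num.sqrt 3)^-1)%:C * D.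
  transitivity (sqrtc ((48 * p%:R / pi)%:C * t') * t'^-1 *
    \sum_(k < ell p) (mixing_mx R p i k)%:C * gauss_transform (mordell_kernel p k.+1) z').
    rewrite mulr_sumr; apply: eq_bigr => k _.
    by rewrite [in LHS]mxE [calL _ _ _ _]mxE (calL_coordE p_prime p_ge5) ?ltn_ord // -/z'; ring.
  rewrite -[RHS]mulrA; congr (_ * _).
  have ik (k : 'I_(ell p)) : cintegrable (fun w => gauss_kernel z' w * (mordell_kernel p k.+1 w)%:C).
    exact: gauss_kernel_integrable z'0 (exp_bounded_mordell_kernel _ _ _).
  have ik' (k : 'I_(ell p)) := cintegrableZ (mixing_mx R p i k)%:C (ik k).
  transitivity (\sum_(k < ell p) cintegral `[0%R, +oo[%classic
     (fun w => (mixing_mx R p i k)%:C * (gauss_kernel z' w * (mordell_kernel p k.+1 w)%:C))).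
    by apply: eq_bigr => k _; rewrite cintegralZ.
  rewrite -(cintegral_sum _ ik').2 /D /gauss_transform -cintegralZ; last first.
    have eD : exp_bounded (dual_kernel p i.+1 : R -> R) := exp_bounded_dual_kernel R p_prime p_ge5 i0 ile.
    exact: gauss_kernel_integrable z'0 eD.
  apply: eq_cintegral => w _.
  have r3 : Num.sqrt 3 != 0 :> R by rewrite gt_eqF // sqrtr_gt0.
  have rp : Num.sqrt p%:R != 0 :> R by rewrite gt_eqF // sqrtr_gt0.
  have key : \sum_(k < ell p) mixing_mx R p i k * mordell_kernel p k.+1 w
     = (Num.sqrt p%:R * Num.sqrt 3)^-1 * dual_kernel p i.+1 w.
    rewrite (dual_kernel_mordell p_prime p_ge5) //.
    rewrite mulrA mulr_sumr; apply: eq_bigr => k _.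
    rewrite mxE /alt_sin.
    have -> : 6 * k.+1%:R * (pi * i.+1%:R / p%:R) = 6 * i.+1%:R * k.+1%:R * pi / p%:R :> R by ring.
    rewrite !exprD.
    by field; rewrite r3 rp.
  rewrite mulrCA -rmorphM -key rmorph_sum mulr_sumr.
  by apply: eq_bigr => k _; rewrite [in RHS]rmorphM mulrCA.
rewrite sum.
(* The four principal roots q1 to q4 are rational expressions in s and the real roots a, b, r, each
   identified as the root with positive real part; the claim then becomes an identity in a field. *)
pose s := sqrtc t; pose a : R := Num.sqrt p%:R; pose b : R := Num.sqrt pi; pose r : R := Num.sqrt 3.
have s0 : 0 < complex.Re s by exact: Re_sqrtc_gt0.
have st : s ^+ 2 = t by exact: sqr_sqrtc.
have a0 : 0 < a by rewrite sqrtr_gt0.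
have b0 : 0 < b by rewrite sqrtr_gt0.
have r0 : 0 < r by rewrite sqrtr_gt0.
have a2 : a ^+ 2 = p%:R by rewrite sqr_sqrtr // ltW.
have b2 : b ^+ 2 = pi by rewrite sqr_sqrtr // ltW.
have r2 : r ^+ 2 = 3 by rewrite sqr_sqrtr.
have sn0 : s != 0 by exact: Re_gt0_neq0.
have q1 : sqrtc ((48 * p%:R / pi)%:C * t) = s * (4 * r * a / b)%:C.
  apply: sqrtc_unique; last by rewrite ReMr mulr_gt0 // divr_gt0 // !mulr_gt0.
  rewrite exprMn st mulrC -rmorphXn; congr (_%:C * _).
  by rewrite -a2 -b2 (_ : 48 = 16 * r ^+ 2); [field; rewrite gt_eqF|rewrite r2; ring].
have q2 : sqrtc ((12 * p%:R)%:C / t) = (2 * r * a)%:C / s.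
  apply: sqrtc_unique; last by apply: divc_Re_gt0; rewrite // !mulr_gt0.
  rewrite expr_div_n st -rmorphXn; congr (_%:C / _).
  by rewrite -a2 (_ : 12 = 4 * r ^+ 2); [ring|rewrite r2; ring].
have q3 : sqrtc (pi%:C / t) = b%:C / s.
  apply: sqrtc_unique; last by apply: divc_Re_gt0.
  by rewrite expr_div_n st -rmorphXn b2.
have q4 : sqrtc ((48 * p%:R / pi)%:C * t') = (4 * r * a * b)%:C / s.
  apply: sqrtc_unique; last by apply: divc_Re_gt0; rewrite // !mulr_gt0.
  rewrite expr_div_n st -rmorphXn /t' -rmorphXn mulrA -rmorphM; congr (_%:C / _).
  by rewrite -a2 -b2 (_ : 48 = 16 * r ^+ 2); [field; rewrite gt_eqF|rewrite r2; ring].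
rewrite q1 q2 q3 q4 -/D -/a -/b -/r /t' -st -b2.
rewrite !(rmorphM, fmorphV, rmorphXn, rmorph_nat) /=.
have toC (x : R) : 0 < x -> x%:C != 0 :> R[i].
  by move=> x0; rewrite -[0]/(0%:C) (inj_eq (@complexI _)) gt_eqF.
move: (toC _ a0) (toC _ b0) (toC _ r0) sn0.
move: (a%:C) (b%:C) (r%:C) (s) (D) => A B S u E A0 B0 S0 u0.
by field; rewrite A0 B0 S0 u0.
Qed.
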